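(* The informational cardinalities of the essential fractal prime set $P_{\text{ess}}$ and of the generalized Cantor set $C_{1/3}$ are $$I(P_{\text{ess}}) = \left(1,\ \frac{1}{2},\ -\zeta(1/2)\right) \approx (1,\ 0.5,\ 1.46035),$$ $$I(C_{1/3}) = \left(1,\ \frac{1}{3},\ 0\right) \approx (1,\ 0.333\ldots,\ 0),$$ where $\zeta$ is the Riemann zeta function.
   Context: The informational cardinality of $M \subset \mathbb{R}$ is the triple $I(M) = (\alpha(M), \delta(M), \iota(M))$, where: the cardinality indicator is $\alpha(M) = 0$ if $|M| \le \aleph_0$ and $\alpha(M) = 1$ if $|M| > \aleph_0$; $\delta(M) = \dim_H(M)$ is the Hausdorff dimension; and $\iota(M)$ is the information measure, whose values for the two sets considered here are fixed by definition: $\iota(P_{\text{ess}}) = -\zeta(1/2)$ and $\iota(C_{1/3}) = 0$. The essential fractal prime set $P_{\text{ess}}$: put $I_0 = [0,1]$. For $n \ge 1$, given $I_{n-1}$ as a union of $2^{n-1}$ disjoint closed intervals of length $4^{-(n-1)}$, divide each of these intervals into four equal closed subintervals of length $4^{-n}$, labeled $0,1,2,3$ from left to right, and retain only the subintervals labeled $1$ and $3$. Let $I_n$ be the union of the retained subintervals at stage $n$. Define $P_{\text{ess}} = \bigcap_{n=1}^\infty I_n$. (The sets $I_n$ are unrelated to the triple $I(M)$.) The generalized Cantor set $C_{1/3}$: let $r = 1/8$, $f_0(x) = rx$, $f_1(x) = rx + (1-r)$. Then $C_{1/3}$ is the unique (nonempty) compact set satisfying $C_{1/3} = f_0(C_{1/3})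 \cup f_1(C_{1/3})$. *)

(* Defs.v *)
From HB Require Import structures.
From mathcomp Require Import all_boot all_order all_algebra.
From mathcomp Require Import all_classical all_reals all_analysis.
From mathcomp Require Import complex.
Set Implicit Arguments.
Unset Strict Implicit.
Unset Printing Implicit Defensive.
Import Order.TTheory GRing.Theory Num.Theory.
Import numFieldNormedType.Exports.
Local Open Scope classical_set_scope.
Local Open Scope complex_scope.
Local Open Scope ring_scope.

Section HausdorffDimension.
Context {R : realType}.
Implicit Types (s d : R) (A U : set R).

Definition diam A : \bar R :=
  ereal_sup [set `|p.1 - p.2|%:E | p in A `*` A].

(* The empty set contributes 0, including for s = 0, where [poweR _ 0 = 1]. *)
Definition diam_pow s U : \bar R :=
  if U == set0 then 0%E else poweR (diam U) s.

Definition hausdorff_pre s d A : \bar R :=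
  ereal_inf [set (\sum_(0 <= i <oo) diam_pow s (U i))%E | U in
    [set U : nat -> set R |
      A `<=` \bigcup_i U i /\ forall i, (diam (U i) <= d%:E)%E]].

(* [hausdorff_pre s d A] is nonincreasing in d, so that its limit as d tends
   to 0 from above is its supremum over d > 0. *)
Definition hausdorff_measure s A : \bar R :=
  ereal_sup [set hausdorff_pre s d A | d in [set d | 0 < d]].

Definition hausdorff_dim A : \bar R :=
  ereal_inf [set s%:E | s in
    [set s | 0 <= s /\ hausdorff_measure s A = 0%E]].

End HausdorffDimension.

Section RiemannZeta.
Context {R : realType}.
(* [R[i]] carries no topology of its own; the alias [R[i]^o] has the one
   induced by the modulus. *)
Local Notation C := (R[i]^o).

Definition analytic_at (f : C -> C) (c : C) : Prop :=
  exists a : nat -> C, \forall z \near c,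
    series (fun k => a k * (z - c) ^+ k : C) @ \oo --> f z.

(* n ^ (- s) = exp (- s * ln n), for n > 0 *)
Definition nat_powN (n : nat) (s : C) : C :=
  (expR (- complex.Re s * ln n%:R))%:C *
  (cos (complex.Im s * ln n%:R) -i* sin (complex.Im s * ln n%:R)).

(* These two conditions determine zeta on the complement of 1 (the identity
   theorem); its value at the pole is unconstrained. *)
Definition is_riemann_zeta (zeta : C -> C) : Prop :=
  (forall s, 1 < complex.Re s ->
     series (fun n => nat_powN n.+1 s) @ \oo --> zeta s) /\
  (forall s, s != 1 -> analytic_at zeta s).

End RiemannZeta.

Section FractalSets.
Context {R : realType}.

(* The pair (a, b) stands for the closed interval [a, b]. *)
Definition quarter (J : R * R) (j : nat) : R * R :=
  (J.1 + j%:R * ((J.2 - J.1) / 4), J.1 + j.+1%:R * ((J.2 - J.1) / 4)).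

Fixpoint ess_intervals (n : nat) : seq (R * R) :=
  if n is m.+1 then
    flatten [seq [:: quarter J 1; quarter J 3] | J <- ess_intervals m]
  else [:: (0, 1)].

Definition ess_stage (n : nat) : set R :=
  [set x | exists2 J, J \in ess_intervals n & J.1 <= x <= J.2].

Definition P_ess : set R := \bigcap_(n in [set n | (1 <= n)%N]) ess_stage n.

Definition cantor_r : R := 8^-1.
Definition cantor_f0 (x : R) : R := cantor_r * x.
Definition cantor_f1 (x : R) : R := cantor_r * x + (1 - cantor_r).

Definition C_third : set R :=
  get [set K : set R |
    [/\ compact K, K !=set0 & K = cantor_f0 @` K `|` cantor_f1 @` K]].

End FractalSets.

Section InformationalCardinality.
Context {R : realType}.

Definition card_indicator (M : set R) : nat := if `[< countable M >] then 0 else 1.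

(* The information measure is a parameter: only its values on P_ess and
   C_third are ever specified. *)
Definition info_card (iota : set R -> R) (M : set R) : nat * \bar R * R :=
  (card_indicator M, hausdorff_dim M, iota M).

Definition info_approx (e : R) (t u : nat * \bar R * R) : Prop :=
  [/\ t.1.1 = u.1.1, (`|t.1.2 - u.1.2| <= e%:E)%E & `|t.2 - u.2| <= e].

End InformationalCardinality.

Arguments P_ess : clear implicits.
Arguments C_third : clear implicits.

(* Main.v *)
Require Import Defs.
From HB Require Import structures.
From mathcomp Require Import all_boot all_order all_algebra.
From mathcomp Require Import all_classical all_reals all_analysis.
From mathcomp Require Import complex.
From mathcomp Require Import ring lra.
Set Implicit Arguments.
Unset Strict Implicit.
Unset Printing Implicit Defensive.
Import Order.TTheory GRing.Theory Num.Theory.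
Import numFieldNormedType.Exports.
Local Open Scope classical_set_scope.
Local Open Scope complex_scope.
Local Open Scope ring_scope.
Import Normc.

(** Two unrelated facts carry the theorem.

    Both fractals are invariant under two similarities of the same ratio [r]
    with disjoint images, [r = 1/4] and [r = 1/8]; the exponent [s] with
    [r `^ s = 1/2] is then the Hausdorff dimension ([self_similar_dim]).  For
    an exponent above [s], the [2 ^ n] images under the words of length [n]
    form covers of vanishing weight.  For the reverse inequality, reading the
    binary digits of a point of [0, 1] as a word gives a map into the fractal,
    an inverse of the Cantor function, such that distances in [0, 1] are at
    most a constant times the power [s] of the distances of the images
    ([coding_expand]).  A cover of the fractal pulls back to a cover of [0, 1], so
    that its weight of exponent [s] is bounded below by the countable
    subadditivity of Lebesgue measure ([mass_distribution]).  The same bound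
    makes the fractals uncountable, since countable sets have no weight.

    The value of zeta at [1/2] is not that of a convergent Dirichlet series.
    The alternating series [eta s], with consecutive terms grouped in pairs,
    converges for [Re s > 0] and has local power series expansions there by
    Weierstrass' theorem on double series ([analytic_series], with the
    majorants of [eta_coef_bound]).  For [Re s > 1] it equals
    [(1 - 2 * 2 ^ - s) * zeta s]; by the identity theorem along a half-line
    that avoids the pole, the equality persists at [1/2] ([zeta_half_eta]).
    On the other hand, [eta (1/2)] is [1 - sqrt 2] times the limit [L] of
    [1 + 1 / sqrt 2 + ... + 1 / sqrt n - 2 * sqrt n], hence [zeta (1/2) = L]
    is real, and two Euler-Maclaurin corrections of this sequence, one
    decreasing and one increasing, enclose [L]: nine terms give the decimals
    ([zeta_half_approx]). *)

(** * Diameters and Hausdorff measure *)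

Section Diameter.
Context {R : realType}.
Implicit Types (U A : set R) (e s : R).

Lemma le_dist_diam U x y : U x -> U y -> (`|x - y|%:E <= diam U)%E.
Proof. by move=> Ux Uy; apply: ereal_sup_ubound; exists (x, y). Qed.

Lemma diam_le U e : (forall x y, U x -> U y -> `|x - y| <= e) ->
  (diam U <= e%:E)%E.
Proof. by move=> h; apply: ge_ereal_sup => _ [[x y] [/= Ux Uy] <-]; rewrite lee_fin h. Qed.

Lemma diam_pow_ge0 s U : (0 <= diam_pow s U)%E.
Proof. by rewrite /diam_pow; case: ifP => // _; exact: poweR_ge0. Qed.

(** A nonempty set of bounded diameter has a real diameter [d], in terms of
    which all its weights are powers of real numbers. *)
Lemma diam_powE U x e : U x -> (diam U <= e%:E)%E ->
  exists2 d : R, 0 <= d <= e & (forall s, diam_pow s U = (d `^ s)%:E) /\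
    forall x y, U x -> U y -> `|x - y| <= d.
Proof.
move=> Ux Ue; have U0 : (0 <= diam U)%E.
  by have := le_dist_diam Ux Ux; rewrite subrr normr0.
have Uf : diam U \is a fin_num.
  by rewrite ge0_fin_numE// (le_lt_trans Ue) ?ltry.
exists (fine (diam U)).
  by rewrite fine_ge0// -lee_fin fineK.
split; last by move=> y z Uy Uz; rewrite -lee_fin fineK//; exact: le_dist_diam.
move=> s; rewrite /diam_pow ifF; last by apply/negbTE/set0P; exists x.
by rewrite -{1}(fineK Uf) poweR_EFin.
Qed.

Lemma diam_pow_le U s e : 0 <= e -> 0 <= s ->
  (forall x y, U x -> U y -> `|x - y| <= e) -> (diam_pow s U <= (e `^ s)%:E)%E.
Proof.
move=> e0 s0 Ue; have [->|/set0P[x Ux]] := eqVneq U set0.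
  by rewrite /diam_pow eqxx lee_fin powR_ge0.
have [d /andP[d0 de] [-> _]] := diam_powE Ux (diam_le Ue).
by rewrite lee_fin ge0_ler_powR.
Qed.

(** Covers of small weight can be required at every scale, so that neither
    the infimum nor the supremum needs to be computed. *)
Lemma hausdorff_measure_eq0 s A :
  (forall d e : R, 0 < d -> 0 < e -> exists U : nat -> set R,
     [/\ A `<=` \bigcup_i U i, forall i, (diam (U i) <= d%:E)%E &
         (\sum_(0 <= i <oo) diam_pow s (U i) <= e%:E)%E]) ->
  hausdorff_measure s A = 0%E.
Proof.
move=> small; apply/eqP; rewrite eq_le; apply/andP; split.
  apply: ge_ereal_sup => _ [d d0 <-]; apply/lee_addgt0Pr => e e0; rewrite add0e.
  have [U [AU Ud Ue]] := small d e d0 e0.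
  by apply: le_trans Ue; apply: ereal_inf_lbound; exists U.
apply: le_trans (_ : hausdorff_pre s 1 A <= _)%E.
  apply: le_ereal_inf_tmp => _ [U _ <-]; apply: nneseries_ge0 => n _ _.
  exact: diam_pow_ge0.
by apply: ereal_sup_ubound; exists 1 => //=.
Qed.

Lemma hausdorff_measure0_cover s A (d e : R) : 0 < d -> 0 < e ->
  hausdorff_measure s A = 0%E ->
  exists2 U : nat -> set R,
    A `<=` \bigcup_i U i /\ forall i, (diam (U i) <= d%:E)%E &
    (\sum_(0 <= i <oo) diam_pow s (U i) < e%:E)%E.
Proof.
move=> d0 e0 HA; have : (hausdorff_pre s d A < e%:E)%E.
  apply: le_lt_trans (_ : _ <= 0)%E _; last by rewrite lte_fin.
  by rewrite -HA; apply: ereal_sup_ubound; exists d.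
by move=> /ereal_inf_lt[_ [U [AU Ud] <-]] Ue; exists U.
Qed.

(** A countable set is covered by points, which weigh nothing. *)
Lemma countable_hausdorff_measure0 s A : 0 < s -> countable A ->
  hausdorff_measure s A = 0%E.
Proof.
move=> s0 /countable_injP[f finj].
apply: hausdorff_measure_eq0 => d e d0 e0.
pose U i := [set x | A x /\ f x = i].
have U0 i x y : U i x -> U i y -> `|x - y| <= 0.
  move=> [Ax fx] [Ay fy]; rewrite (_ : x = y) ?subrr ?normr0//.
  by apply: finj; rewrite ?inE// fx fy.
exists U; split.
- by move=> x Ax; exists (f x).
- move=> i; apply: diam_le => x y Ux Uy.
  by apply: le_trans (U0 i x y Ux Uy) _; exact: ltW.
- rewrite eseries0 ?lee_fin ?(ltW e0)// => i _ _.
  apply/eqP; rewrite eq_le diam_pow_ge0 andbT.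
  apply: le_trans (diam_pow_le _ _ (U0 i)) _ => //; first exact: ltW.
  by rewrite powR0// gt_eqF.
Qed.

End Diameter.

(** * Sets invariant under two similarities *)

Record binary_ifs (R : realType) := BinaryIfs {
  ratio : R; shift0 : R; shift1 : R;
  binary_ifsP : [/\ 0 < ratio, ratio < 2^-1 & shift0 < shift1] }.

Section SelfSimilarSets.
Context {R : realType} (F : binary_ifs R).
Local Notation r := (ratio F).
Local Notation t0 := (shift0 F).
Local Notation t1 := (shift1 F).

Definition branch (b : bool) (x : R) : R := r * x + (if b then t1 else t0).

Definition self_similar (K : set R) :=
  [/\ compact K, K !=set0 & K = branch false @` K `|` branch true @` K].

Section Attractor.
Context (K : set R) (KP : self_similar K).

Definition attractor_width : R := (t1 - t0) / (1 - r).
(** The first piece lies to the left of the second one, and the distance of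
    their convex hulls is this number. *)
Definition attractor_gap : R := t1 - t0 - r * attractor_width.
Local Notation D := attractor_width.
Local Notation gap := attractor_gap.

Lemma branch_self_similar b x : K x -> K (branch b x).
Proof. by move=> Kx; case: KP => _ _ ->; case: b; [right|left]; exists x. Qed.

Lemma self_similar_branch x : K x -> exists b y, K y /\ x = branch b y.
Proof.
move=> Kx; have [_ _ KE] := KP; move: (Kx); rewrite {1}KE => -[] [y Ky <-].
  by exists false, y.
by exists true, y.
Qed.

Lemma attractor_gap_gt0 : 0 < gap.
Proof.
have [r0 r2 t01] := binary_ifsP F.
rewrite (_ : gap = (t1 - t0) * (1 - 2 * r) / (1 - r)).
  by apply: divr_gt0; [apply: mulr_gt0|]; lra.
by rewrite /gap /D; field; rewrite gt_eqF//; lra.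
Qed.

Lemma attractor_width_gt0 : 0 < D.
Proof. by have [r0 r2 t01] := binary_ifsP F; apply: divr_gt0; lra. Qed.

(** The extreme points of the attractor are the fixed points of the two
    branches. *)
Lemma attractor_hull x : K x -> t0 / (1 - r) <= x <= t1 / (1 - r).
Proof.
have [r0 r2 t01] := binary_ifsP F.
move=> Kx; have [Kc K0 _] := KP; have r1 : 0 < 1 - r by lra.
have [M [_ /(_ (M + 1))]] := compact_bounded Kc; rewrite ltrDl ltr01.
move=> /(_ isT) KM; have {}KM y : K y -> `|y| <= M + 1 by exact: KM.
have ubK : has_ubound K.
  by exists (M + 1) => y /KM; apply: le_trans; exact: ler_norm.
have lbK : has_lbound K.
  by exists (- (M + 1)) => y /KM; rewrite ler_norml => /andP[].
have supK : sup K <= r * sup K + t1.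
  apply: ge_sup => // y /self_similar_branch[b [z [Kz ->]]].
  have := ub_le_sup ubK Kz; rewrite /branch => zs.
  by rewrite lerD ?ler_wpM2l ?(ltW r0)//; case: b => //; exact: ltW.
have infK : r * inf K + t0 <= inf K.
  apply: lb_le_inf => // y /self_similar_branch[b [z [Kz ->]]].
  have := ge_inf lbK Kz; rewrite /branch => zs.
  by rewrite lerD ?ler_wpM2l ?(ltW r0)//; case: b => //; exact: ltW.
apply/andP; split.
  by apply: le_trans (ge_inf lbK Kx); rewrite ler_pdivrMr//; lra.
by apply: le_trans (ub_le_sup ubK Kx) _; rewrite ler_pdivlMr//; lra.
Qed.

Lemma attractor_dist_le x y : K x -> K y -> `|x - y| <= D.
Proof.
move=> /attractor_hull/andP[x1 x2] /attractor_hull/andP[y1 y2].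
by rewrite ler_norml /D mulrBl; apply/andP; split; lra.
Qed.

Lemma branch_gap b c x y : b != c -> K x -> K y ->
  gap <= `|branch b x - branch c y|.
Proof.
have [r0 r2 t01] := binary_ifsP F.
move=> bc Kx Ky; have := attractor_dist_le Kx Ky; rewrite ler_norml => /andP[h1 h2].
have h3 := ler_wpM2l (ltW r0) h1; have h4 := ler_wpM2l (ltW r0) h2.
rewrite /branch /gap ler_normr.
by case: b c bc => [] [] // _; apply/orP; [left|right]; lra.
Qed.

(** ** Upper bound for the dimension *)

(** The image of [K] under a word of length [n], whose letters are the binary
    digits of [i], lowest first; the indices [i >= 2 ^ n] are padded with empty
    sets, since a cover is a sequence. *)
Fixpoint word_cover (n i : nat) : set R :=
  if n is m.+1 then branch (odd i) @` word_cover m i./2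
  else if i == 0%N then K else set0.

Lemma word_cover_covers n : K `<=` \bigcup_i word_cover n i.
Proof.
elim: n => [|n IH] x Kx; first by exists 0%N.
have [b [y [Ky ->]]] := self_similar_branch Kx; have [i _ yi] := IH y Ky.
exists (b + i.*2)%N => //=; rewrite half_bit_double oddD odd_double addbF.
by exists y => //; rewrite oddb.
Qed.

Lemma word_cover_big n i : (2 ^ n <= i)%N -> word_cover n i = set0.
Proof.
elim: n i => [|n IH] i; first by case: i.
move=> ni /=; rewrite IH ?image_set0//.
by rewrite -(doubleK (2 ^ n)%N) half_leq// -mul2n -expnS.
Qed.

Lemma word_cover_dist n i x y : word_cover n i x -> word_cover n i y ->
  `|x - y| <= r ^+ n * D.
Proof.
have [r0 r2 t01] := binary_ifsP F.
elim: n i x y => [|n IH] i x y /=.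
  by rewrite mul1r; case: eqP => // _; exact: attractor_dist_le.
move=> [x' x'i <-] [y' y'i <-]; rewrite /branch.
rewrite (_ : _ - _ = r * (x' - y')); last by ring.
rewrite normrM gtr0_norm// exprS -mulrA ler_wpM2l ?(ltW r0)//.
exact: IH y'i.
Qed.

Lemma word_cover_sum s n : 0 <= s ->
  (\sum_(0 <= i <oo) diam_pow s (word_cover n i) <=
   ((2 ^ n)%:R * (r ^+ n * D) `^ s)%:E)%E.
Proof.
have [r0 r2 t01] := binary_ifsP F.
move=> s0; have c0 : 0 <= r ^+ n * D.
  by rewrite mulr_ge0 ?exprn_ge0 ?(ltW r0)// ltW// attractor_width_gt0.
rewrite (nneseries_split 0 (2 ^ n)) => [|k _]; last exact: diam_pow_ge0.
rewrite [X in (_ + X)%E]eseries0 ?adde0 => [|k nk _]; last first.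
  by rewrite word_cover_big// /diam_pow eqxx.
apply: le_trans (_ : \sum_(0 <= k < 2 ^ n) ((r ^+ n * D) `^ s)%:E <= _)%E.
  apply: lee_sum => i _; apply: diam_pow_le => // x y.
  exact: word_cover_dist.
by rewrite sumEFin lee_fin sumr_const_nat subn0 mulr_natl.
Qed.

Lemma self_similar_measure0 s s' : 0 < s -> r `^ s = 2^-1 -> s < s' ->
  hausdorff_measure s' K = 0%E.
Proof.
have [r0 r2 t01] := binary_ifsP F.
move=> s0 rs ss'; have D0 := attractor_width_gt0.
have s'0 : 0 < s' by exact: lt_trans ss'.
(* the cover of level [n] weighs at most [D `^ s' * (2 * r `^ s') ^+ n] *)
have e1 : 1 `^ (s' - s) = 1 :> R by rewrite powR1.
have q1 : `|2 * r `^ s'| < 1.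
  rewrite ger0_norm ?mulr_ge0 ?powR_ge0// (_ : s' = s + (s' - s)); last by ring.
  rewrite powRD; last by rewrite (gt_eqF r0) implybT.
  rewrite rs mulrA mulfV// mul1r -[ltRHS]e1.
  by rewrite gt0_ltr_powR ?nnegrE ?(ltW r0) ?subr_gt0//; lra.
apply: hausdorff_measure_eq0 => d e d0 e0.
have /cvgrPdist_lt/(_ e e0) h1 := cvg_geometric (D `^ s') q1.
have r1 : `|r| < 1 by rewrite gtr0_norm//; lra.
have /cvgrPdist_lt/(_ d d0) h2 := cvg_geometric D r1.
have [n [/= n1 n2]] : exists n, `|0 - geometric (D `^ s') (2 * r `^ s') n| < e /\
    `|0 - geometric D r n| < d.
  by near \oo => n; exists n; split; near: n.
exists (word_cover n); split.
- exact: word_cover_covers.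
- move=> i; apply: diam_le => x y xi yi; apply: le_trans (word_cover_dist xi yi) _.
  move: n2; rewrite sub0r normrN => n2.
  by rewrite mulrC; apply: le_trans (ler_norm _) (ltW n2).
- apply: le_trans (word_cover_sum n (ltW s'0)) _; rewrite lee_fin.
  move: n1; rewrite sub0r normrN => n1.
  apply: le_trans _ (ltW n1); apply: le_trans _ (ler_norm _).
  rewrite powRM ?exprn_ge0 ?(ltW r0) ?(ltW D0)// natrX exprMn.
  have -> : (r ^+ n) `^ s' = (r `^ s') ^+ n.
    by rewrite -powR_mulrn ?(ltW r0)// -powRrM mulrC powRrM powR_mulrn ?powR_ge0.
  by rewrite mulrA mulrC.
Unshelve. all: by end_near. Qed.

(** ** Lower bound for the dimension: an inverse of the Cantor function *)

(** The first binary digit of a point of [0, 1], and the point whose digits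
    are the remaining ones.  Dyadic points get the expansion ending in zeros,
    except 1, which gets the expansion ending in ones. *)
Definition bit (x : R) : bool := 2^-1 <= x.
Definition shift (x : R) : R := 2 * x - (bit x)%:R.

Lemma shift_itv x : 0 <= x <= 1 -> 0 <= shift x <= 1.
Proof.
move=> /andP[x0 x1]; rewrite /shift /bit; case: (leP 2^-1 x) => x2 /=.
  by apply/andP; split; lra.
by apply/andP; split; lra.
Qed.

Lemma shift_dist x y : bit x = bit y -> `|shift x - shift y| = 2 * `|x - y|.
Proof.
move=> xy; rewrite /shift xy (_ : _ - _ = 2 * (x - y)); last by ring.
by rewrite normrM ger0_norm.
Qed.

Fixpoint coding_approx (p : R) (n : nat) (x : R) : R :=
  if n is m.+1 then branch (bit x) (coding_approx p m (shift x)) else p.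

(** The point of [K] whose address is the binary expansion of [x]. *)
Definition coding (x : R) : R := limn (coding_approx (xget 0 K) ^~ x).

Lemma coding_approx_in p n x : K p -> K (coding_approx p n x).
Proof. by move=> Kp; elim: n x => //= n IH x; exact: branch_self_similar. Qed.

Lemma coding_approx_step p n x : K p ->
  `|coding_approx p n.+1 x - coding_approx p n x| <= D * r ^+ n.
Proof.
have [r0 r2 t01] := binary_ifsP F.
move=> Kp; elim: n x => [|n IH] x.
  rewrite expr0 mulr1; apply: attractor_dist_le => //.
  exact: (coding_approx_in 1).
have -> : coding_approx p n.+2 x - coding_approx p n.+1 x =
    r * (coding_approx p n.+1 (shift x) - coding_approx p n (shift x)).
  by rewrite /= /branch; ring.
by rewrite normrM gtr0_norm// exprS mulrCA ler_wpM2l ?IH ?(ltW r0).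
Qed.

Lemma cvg_coding x : coding_approx (xget 0 K) ^~ x @ \oo --> coding x.
Proof.
have [r0 r2 t01] := binary_ifsP F.
have [_ K0 _] := KP; have Kp : K (xget 0 K) by exact: xgetPex.
set u := (coding_approx _ ^~ x); suff : cvgn (series (telescope u)).
  rewrite telescopeK => cu.
  have : cvgn (fun n => u n - u 0%N + u 0%N) by apply: is_cvgD => //; exact: is_cvg_cst.
  by rewrite (_ : (fun _ => _) = u)//; apply/funext => n; rewrite subrK.
apply: normed_cvg; apply: (@series_le_cvg _ _ (geometric D r)).
- by move=> n /=; exact: normr_ge0.
- by move=> n /=; rewrite mulr_ge0 ?exprn_ge0 ?(ltW r0)// ltW// attractor_width_gt0.
- by move=> n /=; rewrite /telescope /u; exact: coding_approx_step.
- by apply: is_cvg_geometric_series; rewrite gtr0_norm//; lra.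
Qed.

Lemma coding_in x : K (coding x).
Proof.
have [Kc K0 _] := KP; have Kp : K (xget 0 K) by exact: xgetPex.
apply: (@closed_cvg _ _ \oo _ (coding_approx (xget 0 K) ^~ x) K _ _ _
  (@cvg_coding x)).
  by apply: compact_closed => //; exact: Rhausdorff.
by near=> n; exact: coding_approx_in.
Unshelve. all: by end_near. Qed.

Lemma codingE x : coding x = branch (bit x) (coding (shift x)).
Proof.
have := @cvg_coding x; rewrite -cvg_shiftS => h.
apply: (cvg_unique _ h) => //; apply: cvgD; last exact: cvg_cst.
by apply: cvgM; [exact: cvg_cst|exact: cvg_coding].
Qed.

(** The coding separates points like the inverse of a Hoelder function of
    exponent [s]: as long as the digits agree, distances are divided by 2 on
    the left and multiplied by [r] on the right, and [r `^ s = 1 / 2]; at the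
    first disagreement the gap separates the images. *)
Lemma coding_expand s x y : 0 < s -> r `^ s = 2^-1 ->
  0 <= x <= 1 -> 0 <= y <= 1 ->
  gap `^ s * `|x - y| <= `|coding x - coding y| `^ s.
Proof.
have [r0 r2 t01] := binary_ifsP F.
move=> s0 rs x01 y01; have gs0 : 0 < gap `^ s by exact: powR_gt0 _ attractor_gap_gt0.
have claim n : forall x y, 0 <= x <= 1 -> 0 <= y <= 1 ->
    `|x - y| <= 2^-1 ^+ n \/ gap `^ s * `|x - y| <= `|coding x - coding y| `^ s.
  have dist1 a b : 0 <= a <= 1 -> 0 <= b <= 1 -> `|a - b| <= 1 :> R.
    by move=> /andP[? ?] /andP[? ?]; rewrite ler_norml; apply/andP; split; lra.
  elim: n => [|n IH] a b a01 b01; first by left; rewrite expr0; exact: dist1.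
  have [ab|ab] := eqVneq (bit a) (bit b); last first.
    right; apply: le_trans (_ : gap `^ s <= _).
      by rewrite ler_piMr ?dist1// ltW.
    rewrite ge0_ler_powR ?nnegrE ?normr_ge0 ?(ltW s0) ?(ltW attractor_gap_gt0)//.
    by rewrite [coding a]codingE [coding b]codingE; apply: branch_gap => //;
      exact: coding_in.
  have := IH _ _ (shift_itv a01) (shift_itv b01); rewrite shift_dist// => -[h|h].
    by left; rewrite exprS; lra.
  right; rewrite [coding a]codingE [coding b]codingE -ab /branch.
  rewrite [X in _ <= `|X| `^ _](_ : _ = r * (coding (shift a) - coding (shift b)));
    last by ring.
  rewrite normrM gtr0_norm// powRM ?normr_ge0 ?(ltW r0)// rs.
  by move: h; rewrite mulrCA; lra.
have [//|lt] := leP (gap `^ s * `|x - y|) (`|coding x - coding y| `^ s).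
suff xy0 : `|x - y| <= 0.
  move: lt; rewrite (_ : `|x - y| = 0) ?mulr0 ?ltNge ?powR_ge0//.
  by apply/eqP; rewrite eq_le xy0 normr_ge0.
apply/ler_addgt0Pr => e e0; rewrite add0r.
have h1 : `|2^-1 : R| < 1 by rewrite gtr0_norm//; lra.
have /cvgrPdist_lt/(_ e e0)[N _ /(_ N (leqnn N))] := cvg_expr h1.
rewrite sub0r normrN => /(le_lt_trans (ler_norm _)) hN.
have [h|h] := claim N x y x01 y01; first exact: le_trans h (ltW hN).
by move: lt; rewrite ltNge h.
Qed.

(** The mass distribution principle: the coding pulls a cover of the
    attractor back to a cover of [0, 1], whose length is 1. *)
Lemma mass_distribution s (U : nat -> set R) : 0 < s -> r `^ s = 2^-1 ->
  K `<=` \bigcup_i U i -> (forall i, (diam (U i) <= 1%:E)%E) ->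
  (1 <= (2 / gap `^ s)%:E * \sum_(0 <= i <oo) diam_pow s (U i))%E.
Proof.
move=> s0 rs KU U1.
have gs0 : 0 < gap `^ s by exact: powR_gt0 _ attractor_gap_gt0.
(* [J i] is the interval of half-length [diam (U i) `^ s / gap `^ s] around any
   point coded into [U i] *)
have pull i : exists J : set R, [/\ measurable J,
    forall x, 0 <= x <= 1 -> U i (coding x) -> J x &
    (lebesgue_measure J <= (2 / gap `^ s)%:E * diam_pow s (U i))%E].
  have [[x [x01 Ux]]|no] := pselect (exists x, 0 <= x <= 1 /\ U i (coding x));
      last first.
    exists set0; split => //.
    - by move=> x x01 Ux; case: no; exists x.
    - by rewrite measure0 mule_ge0 ?diam_pow_ge0// lee_fin divr_ge0// ltW.
  have [d /andP[d0 _] [dE dU]] := diam_powE Ux (U1 i).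
  have c0 : 0 <= d `^ s / gap `^ s by rewrite divr_ge0 ?powR_ge0.
  exists `[x - d `^ s / gap `^ s, x + d `^ s / gap `^ s]%classic; split => //.
  - move=> y y01 Uy; have : `|x - y| <= d `^ s / gap `^ s.
      rewrite ler_pdivlMr// mulrC; apply: le_trans (coding_expand s0 rs x01 y01) _.
      by rewrite ge0_ler_powR ?nnegrE ?(ltW s0)// dU.
    rewrite ler_norml => /andP[h1 h2] /=; rewrite in_itv /=.
    by apply/andP; split; lra.
  - rewrite lebesgue_measure_itv /= lte_fin dE -EFinM; case: ifP => _.
      by rewrite -EFinB lee_fin le_eqVlt; apply/orP; left; apply/eqP; field; rewrite gt_eqF.
    by rewrite lee_fin mulr_ge0 ?powR_ge0// divr_ge0// ltW.
have [J JP] := choice pull.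
apply: (@le_trans _ _ (lebesgue_measure (`[0, 1]%classic : set R))).
  by rewrite lebesgue_measure_itv /= lte_fin ltr01 oppr0 adde0.
have sub := @measure_sigma_subadditive _ _ _ (@lebesgue_measure R)
  `[0, 1]%classic J (fun i => let: And3 mJ _ _ := JP i in mJ).
apply: le_trans (sub _ _) _; first exact: measurable_itv.
- move=> x /=; rewrite in_itv /= => x01.
  have [i _ Ui] := KU _ (coding_in x); exists i => //.
  by have [_ h _] := JP i; exact: h.
- rewrite -nneseriesZl => [|i _]; last exact: diam_pow_ge0.
  apply: lee_nneseries => [i _ _|i _]; first exact: measure_ge0.
  by have [] := JP i.
Qed.

Lemma self_similar_measure_gt0 s s' : 0 < s -> r `^ s = 2^-1 ->
  0 <= s' -> s' <= s -> hausdorff_measure s' K <> 0%E.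
Proof.
move=> s0 rs s'0 s's HK.
have gs0 : 0 < gap `^ s by exact: powR_gt0 _ attractor_gap_gt0.
have g2 : 0 < gap `^ s / 2 by rewrite divr_gt0.
have [U [KU U1] Us] := hausdorff_measure0_cover ltr01 g2 HK.
have : (\sum_(0 <= i <oo) diam_pow s (U i) < (gap `^ s / 2)%:E)%E.
  apply: le_lt_trans Us; apply: lee_nneseries => [i _ _|i _].
    exact: diam_pow_ge0.
  have [->|/set0P[x Ux]] := eqVneq (U i) set0; first by rewrite /diam_pow eqxx.
  have [d /andP[d0 d1] [dE _]] := diam_powE Ux (U1 i).
  rewrite !dE lee_fin; move: d0; rewrite le_eqVlt => /predU1P[<-|d0].
    by rewrite powR0 ?gt_eqF// powR_ge0.
  by rewrite ger_powR// d0.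
move=> Us'; have := mass_distribution s0 rs KU U1; apply/negP; rewrite -ltNge.
have -> : 1%E = ((2 / gap `^ s)%:E * (gap `^ s / 2)%:E)%E :> \bar R.
  by rewrite -EFinM; congr EFin; field; rewrite gt_eqF.
by rewrite lte_pmul2l// lte_fin divr_gt0.
Qed.

Theorem self_similar_dim s : 0 < s -> r `^ s = 2^-1 -> hausdorff_dim K = s%:E.
Proof.
move=> s0 rs; apply/eqP; rewrite eq_le; apply/andP; split.
  apply/lee_addgt0Pr => e e0; apply: ereal_inf_lbound; exists (s + e) => //.
  split; first by rewrite addr_ge0 ?ltW.
  by apply: (self_similar_measure0 s0) => //; rewrite ltrDl.
apply: le_ereal_inf_tmp => _ [s' [s'0 HK] <-]; rewrite lee_fin leNgt.
by apply/negP => /ltW s's; exact: (self_similar_measure_gt0 s0 rs s'0 s's).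
Qed.

Lemma self_similar_uncountable s : 0 < s -> r `^ s = 2^-1 -> ~ countable K.
Proof.
move=> s0 rs Kc; apply: (self_similar_measure_gt0 s0 rs (ltW s0) (lexx s)).
exact: countable_hausdorff_measure0.
Qed.

End Attractor.
End SelfSimilarSets.

(** * Existence of attractors, and the two fractals *)

Section AttractorExistence.
Context {R : realType} (F : binary_ifs R).
Local Notation r := (ratio F).
Local Notation t0 := (shift0 F).
Local Notation t1 := (shift1 F).

(** The branches map [0, 1] to disjoint subintervals of [0, 1], in order. *)
Definition separated := [/\ 0 <= t0, t0 + r < t1 & t1 + r <= 1].

Fixpoint ifs_stage (n : nat) : set R :=
  if n is m.+1 then branch F false @` ifs_stage m `|` branch F true @` ifs_stage m
  else `[0, 1]%classic.

Lemma compact_ifs_stage n : compact (ifs_stage n).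
Proof.
elim: n => [|n IH] /=; first exact: segment_compact.
have cb b : compact (branch F b @` ifs_stage n).
  apply: continuous_compact => //; apply: continuous_subspaceT => x.
  by apply: cvgD; [apply: cvgM; [exact: cvg_cst|exact: cvg_id]|exact: cvg_cst].
by apply: compactU.
Qed.

Context (sepF : separated).

Lemma branch_itv b x : 0 <= x <= 1 -> 0 <= branch F b x <= 1.
Proof.
have [r0 r2 t01] := binary_ifsP F; have [h1 h2 h3] := sepF.
move=> /andP[x0 x1]; have rx0 : 0 <= r * x by rewrite mulr_ge0// ltW.
have rx1 : r * x <= r by rewrite ler_piMr// ltW.
by rewrite /branch; case: b; apply/andP; split; lra.
Qed.

Lemma ifs_stage_itv n x : ifs_stage n x -> 0 <= x <= 1.
Proof.
elim: n x => [|n IH] x /=; first by rewrite in_itv.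
by case=> -[y /IH y01 <-]; exact: branch_itv.
Qed.

Lemma branch_inj_sep b c x y : 0 <= x <= 1 -> 0 <= y <= 1 ->
  branch F b x = branch F c y -> b = c /\ x = y.
Proof.
have [r0 r2 t01] := binary_ifsP F; have [h1 h2 h3] := sepF.
move=> /andP[x0 x1] /andP[y0 y1].
have rx0 : 0 <= r * x by rewrite mulr_ge0// ltW.
have rx1 : r * x <= r by rewrite ler_piMr// ltW.
have ry0 : 0 <= r * y by rewrite mulr_ge0// ltW.
have ry1 : r * y <= r by rewrite ler_piMr// ltW.
rewrite /branch; case: b c => [] [] h; try (by exfalso; lra).
  by split=> //; apply: (mulfI (lt0r_neq0 r0)); lra.
by split=> //; apply: (mulfI (lt0r_neq0 r0)); lra.
Qed.

Definition ifs_attractor : set R := \bigcap_n ifs_stage n.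

(** A point of the intersection has a first letter independent of the stage,
    because the images of [0, 1] are disjoint. *)
Lemma ifs_attractorP : self_similar F ifs_attractor.
Proof.
have [r0 r2 t01] := binary_ifsP F; have [h1 h2 h3] := sepF.
split.
- apply: (@subclosed_compact _ _ (ifs_stage 0)); last by move=> x; exact.
  + apply: closed_bigI => n _; apply: compact_closed; first exact: Rhausdorff.
    exact: compact_ifs_stage.
  + exact: compact_ifs_stage.
- have r1 : 0 < 1 - r by lra.
  exists (t1 / (1 - r)) => n _; elim: n => [|n IH] /=.
    rewrite in_itv /= divr_ge0 ?ler_pdivrMr//; lra.
  right; exists (t1 / (1 - r)) => //; rewrite /branch; field.
  by rewrite gt_eqF.
- apply/seteqP; split => x; last first.
    case=> -[y Ky <-] [|n] _ /=.
    + by rewrite in_itv /=; apply: branch_itv; exact: (ifs_stage_itv (Ky 0%N I)).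
    + by left; exists y => //; exact: Ky.
    + by rewrite in_itv /=; apply: branch_itv; exact: (ifs_stage_itv (Ky 0%N I)).
    + by right; exists y => //; exact: Ky.
  move=> Kx; have [b [y [y01 xE]]] : exists b y, 0 <= y <= 1 /\ x = branch F b y.
    have [] := Kx 1%N I; move=> [y /(@ifs_stage_itv 0) y01 <-].
      by exists false, y.
    by exists true, y.
  have Ky : ifs_attractor y.
    move=> n _; have := Kx n.+1 I; rewrite xE.
    by case=> -[z zn] /(branch_inj_sep (ifs_stage_itv zn) y01)[_ <-].
  by rewrite xE; case: (b); [right|left]; exists y.
Qed.

End AttractorExistence.

Section TwoFractals.
Context {R : realType}.

Lemma ess_ifsP : [/\ 0 < (4^-1 : R), (4^-1 : R) < 2^-1 & (4^-1 : R) < 3 / 4].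
Proof. by split; lra. Qed.
Definition ess_ifs : binary_ifs R := BinaryIfs ess_ifsP.

Lemma third_ifsP : [/\ 0 < (8^-1 : R), (8^-1 : R) < 2^-1 & (0 : R) < 1 - 8^-1].
Proof. by split; lra. Qed.
Definition third_ifs : binary_ifs R := BinaryIfs third_ifsP.

Lemma separated_ess : separated ess_ifs.
Proof. by split => /=; lra. Qed.

Lemma separated_third : separated third_ifs.
Proof. by split => /=; lra. Qed.

(** Dividing an interval commutes with the branches, so that subdividing the
    innermost intervals is the same as applying the branches outermost. *)
Lemma ess_intervals_branch n (J : R * R) : J \in ess_intervals n.+1 <->
  exists b (J' : R * R), J' \in ess_intervals n /\
    J = (branch ess_ifs b J'.1, branch ess_ifs b J'.2).
Proof.
have quarterE (J1 : R * R) b (i : nat) :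
    quarter (branch ess_ifs b J1.1, branch ess_ifs b J1.2) i =
    (branch ess_ifs b (quarter J1 i).1, branch ess_ifs b (quarter J1 i).2).
  by rewrite /quarter /branch /=; congr pair; field.
have stepP m (J1 : R * R) : J1 \in ess_intervals m.+1 <->
    exists (b : bool) (J2 : R * R), J2 \in ess_intervals m /\
      J1 = quarter J2 (if b then 3 else 1).
  split.
    move=> /flatten_mapP[J2 J2m]; rewrite !inE => /orP[]/eqP ->.
      by exists false, J2.
    by exists true, J2.
  move=> [b [J2 [J2m ->]]]; apply/flatten_mapP; exists J2 => //.
  by case: b; rewrite !inE eqxx ?orbT.
elim: n J => [|n IH] J.
  rewrite stepP; split=> -[b [J' []]]; rewrite inE => /eqP -> ->; exists b, (0, 1).
    split; first by rewrite inE.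
    by rewrite /quarter /branch /=; case: b => /=; congr pair; field.
  split; first by rewrite inE.
  by rewrite /quarter /branch /=; case: b => /=; congr pair; field.
rewrite stepP; split.
  move=> [b [J1 [/IH[c [J2 [J2n ->]]] ->]]].
  exists c, (quarter J2 (if b then 3 else 1)); split; last by rewrite quarterE.
  by apply/stepP; exists b, J2.
move=> [c [J1 [/stepP[b [J2 [J2n ->]]] ->]]].
exists b, (branch ess_ifs c J2.1, branch ess_ifs c J2.2); rewrite quarterE.
by split=> //; apply/IH; exists c, J2.
Qed.

Lemma ess_stageE n : ess_stage n = ifs_stage ess_ifs n.
Proof.
elim: n => [|n IH].
  apply/seteqP; split => x /=.
    by move=> [J]; rewrite inE => /eqP -> /=; rewrite in_itv.
  by rewrite in_itv /= => x01; exists (0, 1); rewrite ?inE.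
have br b (x y : R) : (branch ess_ifs b x <= branch ess_ifs b y) = (x <= y).
  by rewrite /branch lerD2r ler_pM2l//=; lra.
have surj b (x : R) : x = branch ess_ifs b (4 * (x - branch ess_ifs b 0)).
  by rewrite /branch /=; field.
have stepS (b : bool) y : ifs_stage ess_ifs n y ->
    ifs_stage ess_ifs n.+1 (branch ess_ifs b y).
  by case: b; [right|left]; exists y.
apply/seteqP; split => x.
  move=> [J /ess_intervals_branch[b [J' [J'n ->]]] /=].
  rewrite (surj b x) !br => xJ.
  by apply: stepS; rewrite -IH; exists J'.
rewrite /= -IH => xs; have [b [y [[J Jn yJ] ->]]] : exists b y, ess_stage n y /\
    x = branch ess_ifs b y.
  by case: xs => -[y yn <-]; [exists false, y|exists true, y].
exists (branch ess_ifs b J.1, branch ess_ifs b J.2); last by rewrite /= !br.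
by apply/ess_intervals_branch; exists b, J.
Qed.

Lemma P_ess_self_similar : self_similar ess_ifs (P_ess R).
Proof.
rewrite (_ : P_ess R = ifs_attractor ess_ifs); first exact: ifs_attractorP separated_ess.
apply/seteqP; split => x Px n _; last by rewrite ess_stageE; exact: Px.
case: n => [|n]; last by rewrite -ess_stageE; exact: Px.
have := Px 1%N isT; rewrite ess_stageE => /(ifs_stage_itv separated_ess).
by rewrite /= in_itv.
Qed.

(** The chosen set has the defining property as soon as some set has it. *)
Lemma C_third_self_similar : self_similar third_ifs (C_third R).
Proof.
have brE b : branch third_ifs b = if b then @cantor_f1 R else @cantor_f0 R.
  apply/funext => x; rewrite /branch /cantor_f0 /cantor_f1 /cantor_r /=.
  by case: b; rewrite ?addr0.
rewrite /self_similar !brE /C_third.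
apply: (@getPex _ [set K : set R | [/\ compact K, K !=set0 &
  K = cantor_f0 @` K `|` cantor_f1 @` K]]).
exists (ifs_attractor third_ifs).
by have := ifs_attractorP separated_third; rewrite /self_similar !brE.
Qed.

Lemma powR_ess : (4^-1 : R) `^ 2^-1 = 2^-1.
Proof.
rewrite powR12_sqrt// (_ : 4^-1 = 2^-1 ^+ 2 :> R); last by lra.
by rewrite sqrtr_sqr ger0_norm.
Qed.

Lemma powR_third : (8^-1 : R) `^ 3^-1 = 2^-1.
Proof.
rewrite (_ : 8^-1 = 2^-1 `^ 3 :> R); first by rewrite -powRrM mulfV ?powRr1.
by rewrite (powR_mulrn 3)//; lra.
Qed.

Lemma info_card_self_similar (F : binary_ifs R) (iota : set R -> R) (K : set R)
    (s : R) : self_similar F K -> 0 < s -> ratio F `^ s = 2^-1 ->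
  info_card iota K = (1%N, s%:E, iota K).
Proof.
move=> FK s0 rs; rewrite /info_card (self_similar_dim FK s0 rs) /card_indicator.
by rewrite asboolF//; exact: self_similar_uncountable FK s s0 rs.
Qed.

End TwoFractals.

(** * Complex sequences and series *)

Section ComplexLimits.
Context {R : realType}.
Local Notation C := (R[i]).
Implicit Types (z w : C) (u v : nat -> C).

Lemma normc_ge0 z : 0 <= normc z.
Proof. by case: z => a b; rewrite sqrtr_ge0. Qed.

Lemma normcR (x : R) : normc x%:C = `|x|.
Proof. by rewrite /= expr0n /= addr0 sqrtr_sqr. Qed.

Lemma normcX z n : normc (z ^+ n) = normc z ^+ n.
Proof.
elim: n => [|n IH]; first by rewrite !expr0 normc1.
by rewrite !exprS normcM IH.
Qed.

Lemma distcC z w : normc (z - w) = normc (w - z).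
Proof. by rewrite -normcN opprB. Qed.

Lemma le_normc_sum (I : Type) (r : seq I) (P : pred I) (F : I -> C) :
  normc (\sum_(i <- r | P i) F i) <= \sum_(i <- r | P i) normc (F i).
Proof.
elim/big_ind2: _ => [|x1 x2 y1 y2 h1 h2|//]; first by rewrite normc0.
exact: le_trans (le_normcD _ _) (lerD h1 h2).
Qed.

Lemma normr_Re_le z : `|complex.Re z| <= normc z.
Proof. by case: z => a b /=; rewrite -sqrtr_sqr ler_wsqrtr// lerDl sqr_ge0. Qed.

Lemma normr_Im_le z : `|complex.Im z| <= normc z.
Proof. by case: z => a b /=; rewrite -sqrtr_sqr ler_wsqrtr// lerDr sqr_ge0. Qed.

Lemma normc_le_ReIm z : normc z <= `|complex.Re z| + `|complex.Im z|.
Proof.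
rewrite {1}(complexE z); apply: le_trans (le_normcD _ _) _.
by rewrite normcM !normcR /= expr0n expr1n /= add0r sqrtr1 mul1r.
Qed.

(** Convergence of complex sequences measured by a real modulus, so that the
    order of the reals is available for the estimates. *)
Definition cvgC u z : Prop := (fun n => normc (u n - z)) @ \oo --> (0 : R).

Lemma cvgCP u z :
  cvgC u z <-> forall e : R, 0 < e -> \forall n \near \oo, normc (u n - z) < e.
Proof.
split=> [/cvgrPdist_lt h e e0|h].
  by apply: filterS (h e e0) => n; rewrite sub0r normrN ger0_norm ?normc_ge0.
apply/cvgrPdist_lt => e e0; apply: filterS (h e e0) => n.
by rewrite sub0r normrN ger0_norm ?normc_ge0.
Qed.

Lemma cvgC_topE u z : ((u : nat -> R[i]^o) @ \oo --> (z : R[i]^o)) <-> cvgC u z.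
Proof.
rewrite cvgCP; split=> [/cvgrPdist_lt h e e0|h].
  have e0' : (0 : C) < e%:C by rewrite ltcR.
  by apply: filterS (h _ e0') => n; rewrite [normc _](distcC) ltcR.
apply/cvgrPdist_lt => -[e e']; rewrite ltcE /= => /andP[/eqP -> e0].
by apply: filterS (h e e0) => n; rewrite distcC -ltcR.
Qed.

Lemma nearC_E (c : C) (P : C -> Prop) :
  (\forall z \near (c : R[i]^o), P z) <->
  exists2 e : R, 0 < e & forall z, normc (z - c) < e -> P z.
Proof.
split=> [/nbhs_ballP[[e e']]|[e e0 h]].
  rewrite /= ltcE /= => /andP[/eqP -> e0] h; exists e => // z zc.
  by apply: h; rewrite -ball_normE /=/ball_ /= distcC -ltcR in zc *.
apply/nbhs_ballP; exists e%:C; first by rewrite /= ltcR.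
by move=> z; rewrite -ball_normE /= => zc; apply: h; rewrite distcC -ltcR.
Qed.

Lemma cvgC_unique u z w : cvgC u z -> cvgC u w -> z = w.
Proof.
move=> /cvgC_topE uz /cvgC_topE uw.
exact: (cvg_unique _ uz uw).
Qed.

Lemma cvgC_dom u z (b : nat -> R) :
  (forall n, normc (u n - z) <= b n) -> b @ \oo --> (0 : R) -> cvgC u z.
Proof.
move=> ub b0; apply: (squeeze_cvgr _ (cvg_cst 0) b0).
by near=> n; rewrite normc_ge0 ub.
Unshelve. all: by end_near. Qed.

Lemma cvgC_cst z : cvgC (fun=> z) z.
Proof. by apply/cvgC_topE; exact: cvg_cst. Qed.

Lemma cvgCD u v z w : cvgC u z -> cvgC v w -> cvgC (fun n => u n + v n) (z + w).
Proof.
move=> uz vw;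
apply: (@cvgC_dom _ _ (fun n => normc (u n - z) + normc (v n - w))); last first.
  by rewrite -[X in _ --> X]addr0; exact: (cvgD uz vw).
by move=> n /=; rewrite opprD addrACA le_normcD.
Qed.

Lemma cvgCN u z : cvgC u z -> cvgC (fun n => - u n) (- z).
Proof.
rewrite /cvgC => uz; rewrite (_ : (fun _ => _) = (fun n => normc (u n - z)))//.
by apply/funext => n; rewrite -opprD normcN.
Qed.

Lemma cvgCB u v z w : cvgC u z -> cvgC v w -> cvgC (fun n => u n - v n) (z - w).
Proof. by move=> uz /cvgCN; exact: cvgCD. Qed.

Lemma cvgCM u v z w : cvgC u z -> cvgC v w -> cvgC (fun n => u n * v n) (z * w).
Proof.
move=> uz vw;
apply: (@cvgC_dom _ _ (fun n => normc (u n - z) * normc (v n - w) +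
  normc (u n - z) * normc w + normc z * normc (v n - w))); last first.
  rewrite -[X in _ --> X](_ : 0 * 0 + 0 * normc w + normc z * 0 = 0); last first.
    by rewrite !mulr0 mul0r !addr0.
  apply: (cvgD (cvgD (cvgM uz vw) (cvgM uz (cvg_cst _))) (cvgM (cvg_cst _) vw)).
move=> n /=; rewrite (_ : u n * v n - z * w =
  (u n - z) * (v n - w) + (u n - z) * w + z * (v n - w)); last by ring.
apply: le_trans (le_normcD _ _) _; rewrite normcM lerD2r.
by apply: le_trans (le_normcD _ _) _; rewrite !normcM.
Qed.

Lemma cvgC_sum (I : Type) (r : seq I) (F : I -> nat -> C) (l : I -> C) :
  (forall i, cvgC (F i) (l i)) ->
  cvgC (fun n => \sum_(i <- r) F i n) (\sum_(i <- r) l i).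
Proof.
move=> h; elim: r => [|i r IH].
  rewrite big_nil; under eq_fun do rewrite big_nil; exact: cvgC_cst.
rewrite big_cons; under eq_fun do rewrite big_cons.
exact: cvgCD.
Qed.

Lemma cvgC_subseq u z (f : nat -> nat) :
  (forall n, (n <= f n)%N) -> cvgC u z -> cvgC (u \o f) z.
Proof.
move=> nf /cvgCP h; apply/cvgCP => e /h [N _ uN].
by exists N => // n /= Nn; apply: uN => /=; exact: leq_trans (nf n).
Qed.

Lemma cvgC_norm_le u z (b : R) :
  cvgC u z -> (\forall n \near \oo, normc (u n) <= b) -> normc z <= b.
Proof.
move=> uz ub; apply/ler_addgt0Pr => e e0.
move/cvgCP: uz => /(_ e e0) uz; near \oo => n.
have h1 : normc (u n) <= b by near: n.
have h2 : normc (u n - z) < e by near: n; exact: uz.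
have -> : z = u n + (z - u n) by rewrite addrC subrK.
by apply: le_trans (le_normcD _ _) _; rewrite distcC in h2; rewrite lerD // ltW.
Unshelve. all: by end_near. Qed.

Lemma cvgC_real (x : nat -> R) (l : R) :
  x @ \oo --> l -> cvgC (fun n => (x n)%:C) l%:C.
Proof.
move=> /cvgrPdist_lt xl; apply/cvgCP => e e0; near=> n.
rewrite -rmorphB normcR distrC; near: n; exact: xl.
Unshelve. all: by end_near. Qed.

Lemma series_real (x : nat -> R) n :
  (series x n)%:C = series (fun k => (x k)%:C) n :> C.
Proof. by rewrite /series /= rmorph_sum. Qed.

(** The comparison test, applied to the real and the imaginary parts. *)
Lemma cvgC_series_dom u (M : nat -> R) :
  (forall k, normc (u k) <= M k) -> cvgn (series M) ->
  exists l, cvgC (series u) l.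
Proof.
move=> uM cM.
have part (f : nat -> R) : (forall k, `|f k| <= normc (u k)) -> cvgn (series f).
  move=> fu; apply: normed_cvg; apply: series_le_cvg cM => n /=.
  - exact: normr_ge0.
  - exact: le_trans (normc_ge0 _) (uM n).
  - exact: le_trans (fu n) (uM n).
have cre := part (fun k => complex.Re (u k)) (fun k => normr_Re_le (u k)).
have cim := part (fun k => complex.Im (u k)) (fun k => normr_Im_le (u k)).
exists ((limn (series (fun k => complex.Re (u k))))%:C +
  'i%C * (limn (series (fun k => complex.Im (u k))))%:C).
have -> : series u = (fun n => (series (fun k => complex.Re (u k)) n)%:C +
                         'i%C * (series (fun k => complex.Im (u k)) n)%:C).
  apply/funext => n; rewrite !series_real /series /= mulr_sumr -big_split /=.
  by apply: eq_bigr => k _; rewrite -complexE.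
apply: cvgCD; first exact: cvgC_real.
by apply: cvgCM; [exact: cvgC_cst|exact: cvgC_real].
Qed.

Lemma sum_half_le (m n : nat) : \sum_(m <= k < n) (2^-1 : R) ^+ k <= 2 * 2^-1 ^+ m.
Proof.
have [nm|mn] := leqP n m.
  by rewrite big_geq// mulr_ge0 // exprn_ge0.
have -> : \sum_(m <= k < n) (2^-1 : R) ^+ k = 2 * 2^-1 ^+ m - 2 * 2^-1 ^+ n.
  elim: n mn => // n IH; rewrite ltnS leq_eqVlt => /predU1P[->|mn].
    by rewrite big_nat1 exprS; lra.
  by rewrite big_nat_recr ?IH//= 1?ltnW// exprS; lra.
by rewrite gerBl mulr_ge0 // exprn_ge0.
Qed.

Lemma series_recr u n : series u n.+1 = series u n + u n.
Proof. by rewrite /series /= big_nat_recr. Qed.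

Lemma series_tailE u K n : (K <= n)%N ->
  series u n - series u K = \sum_(K <= k < n) u k.
Proof.
by move=> Kn; rewrite /series /= (big_cat_nat (leq0n K) Kn) //= addrAC subrr add0r.
Qed.

(** The tail of a geometric series of ratio 1/2 is twice its first term; this
    is what makes the exchange of sums in [analytic_series] uniform. *)
Lemma cvgC_geometric_tail u l (M : R) :
  (forall k, normc (u k) <= M * 2^-1 ^+ k) -> cvgC (series u) l ->
  forall K, normc (series u K - l) <= 2 * M * 2^-1 ^+ K.
Proof.
move=> uM ul K; rewrite distcC.
have M0 : 0 <= M by have := le_trans (normc_ge0 _) (uM 0%N); rewrite expr0 mulr1.
apply: (@cvgC_norm_le (fun n => series u n - series u K)).
  by apply: cvgCB => //; exact: cvgC_cst.
near=> n; have Kn : (K <= n)%N by near: n; exists K.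
rewrite series_tailE //.
apply: le_trans (le_normc_sum _ _ _) _.
apply: le_trans (_ : \sum_(K <= k < n) M * 2^-1 ^+ k <= _); first exact: ler_sum.
by rewrite -mulr_sumr mulrAC [_ * M]mulrC ler_wpM2l // sum_half_le.
Unshelve. all: by end_near. Qed.

Lemma cvg_half_geometric (a : R) : (fun n => a * 2^-1 ^+ n) @ \oo --> (0 : R).
Proof. by apply: cvg_geometric; rewrite ger0_norm // invf_lt1 // ltr1n. Qed.

(** Mertens' product, in the form where both factors decay geometrically: the
    square of indices exceeds the triangle by terms of total size [O(2^-N)]. *)
Lemma cvgC_cauchy_product u v l m (A B : R) :
  (forall k, normc (u k) <= A * 4^-1 ^+ k) ->
  (forall k, normc (v k) <= B * 2^-1 ^+ k) ->
  cvgC (series u) l -> cvgC (series v) m ->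
  cvgC (series (fun n => \sum_(i < n.+1) u i * v (n - i)%N)) (l * m).
Proof.
move=> uA vB ul vm.
have A0 : 0 <= A by have := le_trans (normc_ge0 _) (uA 0%N); rewrite expr0 mulr1.
have B0 : 0 <= B by have := le_trans (normc_ge0 _) (vB 0%N); rewrite expr0 mulr1.
have tri N : series (fun n => \sum_(i < n.+1) u i * v (n - i)%N) N =
    \sum_(i < N) u i * series v (N - i)%N.
  elim: N => [|N IH]; first by rewrite /series /= big_geq// big_ord0.
  rewrite series_recr IH [RHS]big_ord_recr /= subSn // subnn series_recr.
  rewrite [X in _ + X = _]big_ord_recr /= subnn [series v 0]big_geq // add0r addrA.
  congr (_ + _); rewrite -big_split /=; apply: eq_bigr => i _.
  by rewrite -mulrDr subSn 1?ltnW // series_recr.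
have UV N : normc (series u N * series v N -
    series (fun n => \sum_(i < n.+1) u i * v (n - i)%N) N) <= 4 * A * B * 2^-1 ^+ N.
  rewrite tri {1}/series /= big_mkord mulr_suml -sumrB.
  apply: le_trans (le_normc_sum _ _ _) _.
  apply: le_trans (_ : \sum_(i < N) 2 * A * B * 2^-1 ^+ N * 2^-1 ^+ i <= _).
    apply: ler_sum => i _; rewrite -mulrBr normcM.
    have iN := ltnW (ltn_ord i).
    have h : normc (series v N - series v (N - i)%N) <= 2 * B * 2^-1 ^+ (N - i).
      rewrite series_tailE ?leq_subr //.
      apply: le_trans (le_normc_sum _ _ _) _.
      apply: le_trans (_ : \sum_(N - i <= k < N) B * 2^-1 ^+ k <= _).
        exact: ler_sum.
      by rewrite -mulr_sumr mulrAC [_ * B]mulrC ler_wpM2l // sum_half_le.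
    apply: le_trans (ler_pM (normc_ge0 _) (normc_ge0 _) (uA i) h) _.
    rewrite le_eqVlt; apply/orP; left; apply/eqP.
    have -> : (4 : R)^-1 = 2^-1 * 2^-1 by lra.
    rewrite exprMn.
    have -> : (2^-1 : R) ^+ N = 2^-1 ^+ (N - i) * 2^-1 ^+ i.
      by rewrite -exprD subnK.
    ring.
  rewrite -mulr_sumr -(big_mkord xpredT (fun i => 2^-1 ^+ i)).
  apply: le_trans (ler_wpM2l _ (sum_half_le 0 N)) _.
    by rewrite !mulr_ge0 // exprn_ge0.
  by rewrite expr0 mulr1 (_ : _ * 2 = 4 * A * B * 2^-1 ^+ N)//; ring.
have e : (fun N => series u N * series v N - (series u N * series v N -
    series (fun n => \sum_(i < n.+1) u i * v (n - i)%N) N)) =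
    series (fun n => \sum_(i < n.+1) u i * v (n - i)%N).
  by apply/funext => N; rewrite opprB addrC subrK.
rewrite -e -[l * m]subr0; apply: cvgCB; first exact: cvgCM.
apply: cvgC_dom (cvg_half_geometric (4 * A * B)) => N.
by rewrite subr0 UV.
Qed.

End ComplexLimits.

(** * Functions with local power series expansions *)

Section AnalyticFunctions.
Context {R : realType}.
Local Notation C := (R[i]).
Implicit Types (f g : C -> C) (c z w : C) (a : nat -> C).

Lemma cvgC_series_bounded (u : nat -> C) l :
  cvgC (series u) l -> exists M : R, forall k, normc (u k) <= M.
Proof.
move=> ul; have u0 : cvgC u 0.
  rewrite -(subrr l) (_ : u = (fun n => series u n.+1 - series u n)).
    by apply: cvgCB => //; apply: (@cvgC_subseq _ _ _ succn).
  by apply/funext => n; rewrite series_recr addrAC subrr add0r.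
have : cvgn (fun n => normc (u n - 0)) by apply/cvg_ex; exists 0.
move=> /cvg_seq_bounded/bounded_fun_has_ubound[M Mu].
by exists M => k; apply: Mu; exists k; rewrite // subr0.
Qed.

(** Convergence at one point of the boundary circle bounds the terms there,
    which yields the bound on the coefficients. *)
Lemma analyticP f c : analytic_at (f : R[i]^o -> R[i]^o) c <->
  exists a (r M : R), [/\ 0 < r, forall k, normc (a k) * r ^+ k <= M &
    forall w, normc w <= r -> cvgC (series (fun k => a k * w ^+ k)) (f (c + w))].
Proof.
split=> [[a /nearC_E[e e0 h]]|[a [r [M [r0 _ h]]]]]; last first.
  exists a; apply/nearC_E; exists r => // z zc; apply/cvgC_topE.
  by have := h (z - c) (ltW zc); rewrite subrKC.
have conv w : normc w <= e / 2 -> cvgC (series (fun k => a k * w ^+ k)) (f (c + w)).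
  move=> we; have : normc (c + w - c) < e.
    by rewrite addrAC subrr add0r (le_lt_trans we)// ltr_pdivrMr// ltr_pMr// ltr1n.
  by move=> /h /cvgC_topE; rewrite addrAC subrr add0r.
have e2 : 0 < e / 2 by rewrite divr_gt0.
have /conv/cvgC_series_bounded[M aM] : normc (e / 2)%:C <= e / 2.
  by rewrite normcR ger0_norm // ltW.
exists a, (e / 2), M; split=> // k.
by have := aM k; rewrite normcM normcX normcR ger0_norm // ltW.
Qed.

Lemma normc_term_le (x : C) (r M t : R) w k :
  0 < r -> 0 <= t -> normc x * r ^+ k <= M -> normc w <= t * r ->
  normc (x * w ^+ k) <= M * t ^+ k.
Proof.
move=> r0 t0 xM wt; rewrite normcM normcX.
apply: le_trans (_ : normc x * (t * r) ^+ k <= _).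
  by rewrite ler_wpM2l ?normc_ge0// lerXn2r ?nnegrE ?normc_ge0// mulr_ge0// ltW.
by rewrite exprMn mulrCA mulrC ler_wpM2r// exprn_ge0.
Qed.

Lemma coef_bound_shrink (x : C) (r r' M : R) k :
  0 < r' -> r' <= r -> normc x * r ^+ k <= M -> normc x * r' ^+ k <= M.
Proof.
move=> r0 rr; apply: le_trans; rewrite ler_wpM2l ?normc_ge0//.
by rewrite lerXn2r ?nnegrE ?(ltW r0)// (le_trans (ltW r0)).
Qed.

Lemma analyticM f g c : analytic_at (f : R[i]^o -> R[i]^o) c ->
  analytic_at (g : R[i]^o -> R[i]^o) c ->
  analytic_at ((fun z => f z * g z) : R[i]^o -> R[i]^o) c.
Proof.
move=> /analyticP[a [r [M [r0 aM fa]]]] /analyticP[b [s [N [s0 bN gb]]]].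
pose m := Num.min r s; have m0 : 0 < m by rewrite lt_min r0.
have mr : m <= r by rewrite ge_min lexx.
have ms : m <= s by rewrite ge_min lexx orbT.
exists (fun n => \sum_(i < n.+1) a i * b (n - i)%N); apply/nearC_E.
exists (4^-1 * m); first by rewrite mulr_gt0.
move=> z /ltW zc; set w := z - c in zc *; apply/cvgC_topE.
have zE : z = c + w by rewrite /w subrKC.
have w2 : normc w <= 2^-1 * m.
  by apply: le_trans zc _; rewrite ler_wpM2r ?(ltW m0)//; lra.
have wm : normc w <= m by apply: le_trans w2 _; rewrite ler_piMl ?(ltW m0)//; lra.
have -> : series (fun n => (\sum_(i < n.+1) a i * b (n - i)%N) * w ^+ n) =
  series (fun n => \sum_(i < n.+1) (a i * w ^+ i) * (b (n - i)%N * w ^+ (n - i))).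
  congr series; apply/funext => n; rewrite mulr_suml; apply: eq_bigr => i _.
  by rewrite mulrACA -exprD subnKC // -ltnS.
rewrite zE; apply: (@cvgC_cauchy_product _ (fun i => a i * w ^+ i) (fun i => b i * w ^+ i) _ _ M N).
- by move=> k /=; apply: (@normc_term_le _ m) => //; exact: coef_bound_shrink mr (aM k).
- by move=> k /=; apply: (@normc_term_le _ m) => //; exact: coef_bound_shrink ms (bN k).
- by apply: fa; exact: le_trans mr.
- by apply: gb; exact: le_trans ms.
Qed.

Lemma analyticB f g c : analytic_at (f : R[i]^o -> R[i]^o) c ->
  analytic_at (g : R[i]^o -> R[i]^o) c ->
  analytic_at ((fun z => f z - g z) : R[i]^o -> R[i]^o) c.
Proof.
move=> /analyticP[a [r [M [r0 aM fa]]]] /analyticP[b [s [N [s0 bN gb]]]].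
pose m := Num.min r s; have m0 : 0 < m by rewrite lt_min r0.
exists (fun n => a n - b n); apply/nearC_E; exists m => //.
move=> z /ltW; set w := z - c => wm; apply/cvgC_topE.
have zE : z = c + w by rewrite /w subrKC.
have -> : series (fun n => (a n - b n) * w ^+ n) =
  (fun n => series (fun n => a n * w ^+ n) n - series (fun n => b n * w ^+ n) n).
  apply/funext => n; rewrite /series /= -sumrB.
  by apply: eq_bigr => i _; rewrite mulrBl.
rewrite zE; apply: cvgCB.
- by apply: fa; rewrite (le_trans wm)// ge_min lexx.
- by apply: gb; rewrite (le_trans wm)// ge_min lexx orbT.
Qed.

(** Weierstrass' theorem: with coefficients dominated on one circle by a
    convergent series, the double series can be summed in either order,
    because the remainders after [K] powers are at most [2 M_n 2^-K]. *)
Lemma analytic_series (p : nat -> C -> C) f c (a : nat -> nat -> C) (r : R)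
    (M : nat -> R) :
  0 < r -> (forall n k, normc (a n k) * r ^+ k <= M n) -> cvgn (series M) ->
  (forall n w, normc w <= r ->
     cvgC (series (fun k => a n k * w ^+ k)) (p n (c + w))) ->
  (forall w, normc w <= r -> cvgC (series (fun n => p n (c + w))) (f (c + w))) ->
  analytic_at (f : R[i]^o -> R[i]^o) c.
Proof.
move=> r0 aM cM ap pf.
have M0 n : 0 <= M n by rewrite (le_trans _ (aM n 0%N))// mulr_ge0 ?normc_ge0 ?exprn_ge0 ?ltW.
have SM N : series M N <= limn (series M).
  by apply: nondecreasing_cvgn_le cM N; exact: nondecreasing_series.
have colP k : exists l, cvgC (series (fun n => a n k)) l.
  apply: (@cvgC_series_dom _ _ (fun n => (r ^+ k)^-1 * M n)).
    by move=> n; rewrite mulrC ler_pdivlMr ?exprn_gt0.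
  rewrite (_ : series _ = (fun n => (r ^+ k)^-1 * series M n)).
    exact: is_cvgMr.
  by apply/funext => n; rewrite /series /= mulr_sumr.
have [A colA] := choice colP.
exists A; apply/nearC_E; exists (2^-1 * r); first by rewrite mulr_gt0.
move=> z /ltW; set w := z - c => wr; apply/cvgC_topE.
have zE : z = c + w by rewrite /w subrKC.
have wr1 : normc w <= r by apply: le_trans wr _; rewrite ler_piMl ?(ltW r0)//; lra.
apply: cvgC_dom (cvg_half_geometric (2 * limn (series M))) => K; rewrite zE.
apply: (@cvgC_norm_le _ (fun N => \sum_(0 <= k < K) series (a^~ k) N * w ^+ k -
  series (fun n => p n (c + w)) N)).
  apply: cvgCB; last exact: pf.
  by apply: cvgC_sum => k; apply: cvgCM => //; exact: cvgC_cst.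
near=> N.
have -> : \sum_(0 <= k < K) series (a^~ k) N * w ^+ k =
    \sum_(0 <= n < N) series (fun k => a n k * w ^+ k) K.
  rewrite /series /= exchange_big /=; apply: eq_bigr => k _.
  by rewrite mulr_suml.
rewrite {2}/series /= -sumrB; apply: le_trans (le_normc_sum _ _ _) _.
apply: le_trans (_ : \sum_(0 <= n < N) 2 * 2^-1 ^+ K * M n <= _).
  apply: ler_sum => n _; rewrite mulrAC.
  apply: cvgC_geometric_tail; last exact: ap.
  by move=> k; apply: (@normc_term_le _ r).
rewrite -mulr_sumr mulrAC; apply: ler_wpM2r; first exact: exprn_ge0.
by apply: ler_wpM2l => //; exact: SM.
Unshelve. all: by end_near. Qed.

(** A nonzero power series does not vanish along a half-line ending at its
    centre: the lowest nonvanishing term dominates the others nearby. *)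
Lemma analytic_zero_germ f c d : analytic_at (f : R[i]^o -> R[i]^o) c ->
  d != 0 -> (forall t : R, 0 < t -> f (c + t%:C * d) = 0) ->
  exists2 e : R, 0 < e & forall z, normc (z - c) < e -> f z = 0.
Proof.
move=> /analyticP[a [r [M [r0 aM fa]]]] d0 f0.
have nd : 0 < normc d.
  rewrite lt_neqAle normc_ge0 andbT eq_sym; apply: contra d0 => /eqP/eq0_normc.
  by move=> ->.
have M0 : 0 <= M by rewrite (le_trans _ (aM 0%N))// mulr_ge0 ?normc_ge0 ?exprn_ge0 ?ltW.
have a0 k : a k = 0.
  elim/ltn_ind: k => k IH; apply: eq0_normc; apply/eqP.
  rewrite eq_le normc_ge0 andbT leNgt; apply/negP => ak.
  (* [w] has modulus [x], for which the tail bound [2 * M * (x / r) ^+ k.+1] is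
     smaller than the modulus of the term of index [k] *)
  pose x := Num.min (2^-1 * r) (normc (a k) * r ^+ k.+1 / (8 * (M + 1))).
  have x0 : 0 < x.
    rewrite lt_min mulr_gt0//= !mulr_gt0 ?exprn_gt0// invr_gt0; lra.
  pose w : C := (x / normc d)%:C * d.
  have wx : normc w = x.
    rewrite normcM normcR ger0_norm ?divr_ge0 ?normc_ge0 ?ltW//.
    by rewrite divfK// gt_eqF.
  have xr : x <= 2^-1 * r by rewrite ge_min lexx.
  have wr1 : normc w <= r by rewrite wx; lra.
  have := fa w wr1; rewrite f0 ?divr_gt0// => sw.
  have := @cvgC_norm_le _ (fun n => series (fun j => a j * w ^+ j) n -
      series (fun j => a j * w ^+ j) k.+1) _ (2 * M * (x / r) ^+ k.+1).
  have xr2 : x / r <= 2^-1 by rewrite ler_pdivrMr.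
  have xr0 : 0 <= x / r by rewrite divr_ge0 ?ltW.
  have skE : series (fun j => a j * w ^+ j) k.+1 = a k * w ^+ k.
    rewrite series_recr /series /= big_nat big1 ?add0r// => j /andP[_ jk].
    by rewrite IH// mul0r.
  rewrite skE => /(_ _ (cvgCB sw (cvgC_cst _)))-H.
  have {H} : normc (0 - a k * w ^+ k) <= 2 * M * (x / r) ^+ k.+1.
    apply: H; near=> n; have kn : (k.+1 <= n)%N by near: n; exists k.+1.
    rewrite -skE series_tailE//; apply: le_trans (le_normc_sum _ _ _) _.
    apply: le_trans (_ : \sum_(k.+1 <= j < n) (M * (x / r) ^+ k.+1) *
       2^-1 ^+ (j - k.+1) <= _).
      rewrite big_nat [leRHS]big_nat; apply: ler_sum => j /andP[kj _].
      apply: le_trans (@normc_term_le _ r M (x / r) _ _ r0 xr0 (aM j) _) _.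
        by rewrite wx divfK// gt_eqF.
      rewrite -{1}(subnKC kj) exprD mulrA ler_wpM2l//.
        by rewrite mulr_ge0// exprn_ge0.
      by rewrite lerXn2r ?nnegrE.
    rewrite -mulr_sumr mulrC -mulrA ler_wpM2r ?mulr_ge0 ?exprn_ge0//.
    rewrite -{1}(add0n k.+1) big_addn; under eq_bigr do rewrite addnK.
    by apply: le_trans (sum_half_le _ _) _; rewrite expr0 mulr1.
  rewrite sub0r normcN normcM normcX wx expr_div_n mulrA ler_pdivlMr ?exprn_gt0//.
  rewrite [x ^+ k.+1]exprS => H.
  have : normc (a k) * r ^+ k.+1 <= 2 * M * x.
    rewrite -(ler_pM2r (exprn_gt0 k x0)) (le_trans _ (le_trans H _))//.
      by rewrite mulrAC.
    by rewrite mulrA.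
  have xa : x * (8 * (M + 1)) <= normc (a k) * r ^+ k.+1.
    by rewrite -ler_pdivlMr ?ge_min ?lexx ?orbT//; lra.
  have : 0 < normc (a k) * r ^+ k.+1 by rewrite mulr_gt0 ?exprn_gt0.
  nra.
exists r => // z /ltW zc; apply: (@cvgC_unique _ (fun=> 0)); last exact: cvgC_cst.
have := fa _ zc; rewrite subrKC; congr (cvgC _ _); apply/funext => n.
by rewrite /series /= big1// => k _; rewrite a0 mul0r.
Unshelve. all: by end_near. Qed.

End AnalyticFunctions.

(** * The complex exponential *)

Section ComplexExponential.
Context {R : realType}.
Local Notation C := (R[i]).
Implicit Types (z w c s : C) (x y : R).

Definition cexp z : C :=
  (expR (complex.Re z))%:C * (cos (complex.Im z) +i* sin (complex.Im z)).

Lemma cexpD z w : cexp (z + w) = cexp z * cexp w.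
Proof.
case: z w => [a b] [a' b']; rewrite /cexp /= expRD cosD sinD rmorphM /=.
rewrite [RHS]mulrACA; apply: congr1; apply/eqP; rewrite eq_complex /= eqxx /=.
by rewrite addrC.
Qed.

Lemma cexp_real x : cexp x%:C = (expR x)%:C.
Proof. by rewrite /cexp /= cos0 sin0 mulr1. Qed.

Lemma normc_cexp z : normc (cexp z) = expR (complex.Re z).
Proof.
rewrite normcM normcR ger0_norm ?expR_ge0//= cos2Dsin2 sqrtr1.
by rewrite mulr1.
Qed.

Lemma exp_coeff_le_expR x k : 0 <= x -> x ^+ k / k`!%:R <= expR x.
Proof.
move=> x0; case: k => [|k]; first by rewrite expr0 fact0 divr1 -expR0 ler_expR.
by apply: le_trans (expR_ge1Dxn k x0); rewrite lerDr.
Qed.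

Lemma normc_exp_term z k : normc (z ^+ k / k`!%:R) = normc z ^+ k / k`!%:R.
Proof.
rewrite normcM normcX normcV (_ : k`!%:R = (k`!%:R : R)%:C); last by rewrite rmorph_nat.
by rewrite normcR ger0_norm.
Qed.

Lemma normc_exp_term_le z k :
  normc (z ^+ k / k`!%:R) <= expR (4 * normc z) * 4^-1 ^+ k.
Proof.
rewrite normc_exp_term exprVn ler_pdivlMr ?exprn_gt0//.
rewrite mulrAC -exprMn [_ * 4]mulrC; apply: exp_coeff_le_expR.
by rewrite mulr_ge0 // normc_ge0.
Qed.

Lemma cvgC_exp_real x :
  cvgC (series (fun k => x%:C ^+ k / k`!%:R)) (expR x)%:C.
Proof.
have := @cvgC_real _ _ _ (is_cvg_series_exp_coeff x).
congr cvgC; apply/funext => n; rewrite series_real; congr (series _ n).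
by apply/funext => k; rewrite /exp_coeff /= rmorphM rmorphXn fmorphV rmorph_nat.
Qed.

Lemma cvgC_exp_imag y :
  cvgC (series (fun k => ('i%C * y%:C) ^+ k / k`!%:R)) (cos y +i* sin y).
Proof.
have /cvgC_real hc := @is_cvg_series_cos_coeff _ y.
have /cvgC_real hs := @is_cvg_series_sin_coeff _ y.
have {hc} : cvgC (fun n => (series (cos_coeff y) n)%:C) (cos y)%:C.
  by rewrite unlock.
have {hs} : cvgC (fun n => (series (sin_coeff y) n)%:C) (sin y)%:C.
  by rewrite unlock.
move=> hs hc; have := cvgCD hc (cvgCM (cvgC_cst 'i%C) hs).
rewrite [cos y +i* sin y]complexE; congr cvgC; apply/funext => n.
rewrite !series_real /series /= mulr_sumr -big_split /=; apply: eq_bigr => k _.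
rewrite exprMn -(odd_double_half k) /cos_coeff /sin_coeff /=.
have i2 m : 'i%C ^+ m.*2 = (-1) ^+ m :> C by rewrite -mul2n exprM sqr_i.
have e2 m : ((m%:R : R)^-1)%:C = m%:R^-1 :> C by rewrite fmorphV rmorph_nat.
case: (odd k); rewrite /= ?add1n ?add0n ?oddS odd_double /= ?doubleK ?uphalf_double.
  rewrite !mul0r mul1r add0r ['i%C ^+ _.+1]exprS i2 !rmorphM /= !rmorphXn /=.
  by rewrite rmorphN1 e2 !mulrA.
by rewrite -exprnP !mul0r mulr0 addr0 mul1r i2 !rmorphM /= !rmorphXn /= rmorphN1 e2.
Qed.

(** The Cauchy product of the series at [x] and at [i * y], rearranged by the
    binomial formula. *)
Lemma cvgC_cexp z : cvgC (series (fun k => z ^+ k / k`!%:R)) (cexp z).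
Proof.
case: z => x y; set u := (fun k => x%:C ^+ k / k`!%:R : C).
set v := (fun k => ('i%C * y%:C) ^+ k / k`!%:R : C).
have vle k : normc (v k) <= expR (4 * normc ('i%C * y%:C)) * 2^-1 ^+ k.
  apply: le_trans (normc_exp_term_le _ _) _; rewrite ler_wpM2l ?expR_ge0//.
  by rewrite lerXn2r ?nnegrE //; lra.
have := cvgC_cauchy_product (normc_exp_term_le x%:C) vle (cvgC_exp_real x)
  (cvgC_exp_imag y).
congr cvgC; apply/funext => n; congr (series _ n); apply/funext => k.
rewrite [x +i* y]complexE /= addrC exprDn mulr_suml; apply: eq_bigr => i _.
have ik : (i <= k)%N by rewrite -ltnS.
have f0 m : m`!%:R != 0 :> C by rewrite pnatr_eq0 -lt0n fact_gt0.
have b0 : 'C(k, i)%:R != 0 :> C by rewrite pnatr_eq0 -lt0n bin_gt0.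
rewrite /v -mulr_natr -(bin_fact ik) !natrM; field.
by rewrite !f0 b0.
Qed.

Lemma expRB1_le x : expR x - 1 <= x * expR x.
Proof.
have := ler_wpM2l (expR_ge0 x) (expR_ge1Dx (- x)).
by rewrite expRxMexpNx_1; lra.
Qed.

Lemma normc_cexpB1 z : normc (cexp z - 1) <= normc z * expR (normc z).
Proof.
apply: le_trans (expRB1_le _).
apply: (cvgC_norm_le (u := fun n => series (fun k => z ^+ k / k`!%:R) n - 1)).
  by apply: cvgCB (cvgC_cst _); exact: cvgC_cexp.
have partial n : series (exp_coeff (normc z)) n <= expR (normc z).
  apply: nondecreasing_cvgn_le (is_cvg_series_exp_coeff _) n.
  by apply: nondecreasing_series => k _ _; apply: exp_coeff_ge0; exact: normc_ge0.
near=> n; have n1 : (1 <= n)%N by near: n; exists 1%N.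
have s1 (t : C) : series (fun k => t ^+ k / k`!%:R) 1 = 1.
  by rewrite /series /= big_nat1 expr0 fact0 divr1.
rewrite -[X in _ - X](s1 z) series_tailE//; apply: le_trans (le_normc_sum _ _ _) _.
under eq_bigr do rewrite normc_exp_term.
have e1 : series (exp_coeff (normc z)) 1 = 1.
  by rewrite /series /= big_nat1 /exp_coeff /= expr0 fact0 divr1.
have -> : \sum_(1 <= k < n) normc z ^+ k / k`!%:R =
    series (exp_coeff (normc z)) n - 1.
  by rewrite -[X in _ - X]e1 /series /= (big_cat_nat (leq0n 1) n1) //= addrAC subrr add0r.
by rewrite lerD2r; exact: partial.
Unshelve. all: by end_near. Qed.

Lemma nat_powNE n s : nat_powN n (s : R[i]^o) = cexp (- s * (ln n%:R)%:C).
Proof.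
case: s => a b; rewrite /nat_powN /cexp /=.
by rewrite !mulr0 subr0 add0r !mulNr cosN sinN.
Qed.

(** For [l = ln n] this is the expansion of [n ^ - s] at [c]. *)
Lemma cvgC_cexp_shift c w (l : R) :
  cvgC (series (fun k => cexp (- c * l%:C) * (- l%:C) ^+ k / k`!%:R * w ^+ k))
    (cexp (- (c + w) * l%:C)).
Proof.
rewrite opprD mulrDl cexpD.
have := cvgCM (cvgC_cst (cexp (- c * l%:C))) (cvgC_cexp (- w * l%:C)).
congr cvgC; apply/funext => n; rewrite /series /= mulr_sumr.
by apply: eq_bigr => k _; rewrite (_ : - w * l%:C = - l%:C * w) ?exprMn; ring.
Qed.

Lemma analytic_cst z c : analytic_at ((fun=> z) : R[i]^o -> R[i]^o) c.
Proof.
exists (fun k => if k == 0%N then z else 0); apply/nearC_E; exists 1 => // w _.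
apply/cvgC_topE; apply/cvgCP => e e0; near=> n.
have n0 : (0 < n)%N by near: n; exists 1%N.
rewrite /series /= big_ltn// expr0 mulr1 big_nat big1 ?addr0 ?subrr ?normc0//.
by case=> // k _; rewrite /= mul0r.
Unshelve. all: by end_near. Qed.

Lemma analytic_nat_powN n c : analytic_at (nat_powN n : R[i]^o -> R[i]^o) c.
Proof.
exists (fun k => cexp (- c * (ln n%:R)%:C) * (- (ln n%:R)%:C) ^+ k / k`!%:R).
apply/nearC_E; exists 1 => // z _; apply/cvgC_topE.
have := cvgC_cexp_shift c (z - c) (ln n%:R); rewrite subrKC.
by rewrite nat_powNE.
Qed.

End ComplexExponential.

(** * The alternating zeta function *)

Section DirichletEta.
Context {R : realType}.
Local Notation C := (R[i]).
Implicit Types (c s w : C).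

(** The terms of the alternating series in pairs: grouping them makes the
    convergence absolute on the half-plane [Re s > 0]. *)
Definition eta_term (n : nat) s : C := nat_powN n.*2.+1 s - nat_powN n.*2.+2 s.

Definition eta s : C := xget 0 [set l | cvgC (series (eta_term^~ s)) l].

Definition eta_coef c (n k : nat) : C :=
  cexp (- c * (ln n.*2.+1%:R)%:C) * (- (ln n.*2.+1%:R)%:C) ^+ k / k`!%:R -
  cexp (- c * (ln n.*2.+2%:R)%:C) * (- (ln n.*2.+2%:R)%:C) ^+ k / k`!%:R.

Lemma cvgC_eta_coef c w n :
  cvgC (series (fun k => eta_coef c n k * w ^+ k)) (eta_term n (c + w)).
Proof.
have := cvgCB (cvgC_cexp_shift c w (ln n.*2.+1%:R))
  (cvgC_cexp_shift c w (ln n.*2.+2%:R)).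
rewrite /eta_term !nat_powNE; congr cvgC; apply/funext => m.
by rewrite /series /= -sumrB; apply: eq_bigr => k _; rewrite /eta_coef mulrBl.
Qed.

Lemma exprB_le (x y : R) k : 0 <= x -> x <= y ->
  y ^+ k.+1 - x ^+ k.+1 <= (y - x) * (k.+1%:R * y ^+ k).
Proof.
move=> x0 xy; have y0 := le_trans x0 xy.
rewrite subrXX ler_wpM2l ?subr_ge0//.
apply: le_trans (_ : \sum_(i < k.+1) y ^+ k <= _); last first.
  by rewrite sumr_const card_ord mulr_natl.
apply: ler_sum => i _; have ik : (i <= k)%N by rewrite -ltnS.
rewrite /= -[X in _ <= y ^+ X](subnK ik) exprD ler_wpM2l ?exprn_ge0//.
by rewrite lerXn2r.
Qed.

(** Consecutive terms nearly cancel: with [x] and [y] the logarithms, their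
    difference carries a factor [y - x], which the telescoping right-hand side
    absorbs.  Half of the decay rate [complex.Re c] pays for the factor
    [kappa ^+ k] of the circle of radius [kappa]. *)
Lemma eta_coef_bound c (x y kappa : R) k :
  0 < kappa -> complex.Re c = 2 * kappa -> 0 <= x -> x <= y -> y - x <= 1 ->
  normc (cexp (- c * x%:C) * (- x%:C) ^+ k / k`!%:R -
         cexp (- c * y%:C) * (- y%:C) ^+ k / k`!%:R) * kappa ^+ k <=
  (normc c * expR (normc c) + kappa) / kappa *
    (expR (- (kappa * x)) - expR (- (kappa * y))).
Proof.
move=> k0 cE x0 xy u1; set u := y - x in u1 *.
have y0 := le_trans x0 xy; have u0 : 0 <= u by rewrite subr_ge0.
have yE : y = x + u by rewrite /u subrKC.
have -> : cexp (- c * x%:C) * (- x%:C) ^+ k / k`!%:R -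
          cexp (- c * y%:C) * (- y%:C) ^+ k / k`!%:R =
  (-1) ^+ k * cexp (- c * y%:C) * ((cexp (c * u%:C) - 1) * (x ^+ k / k`!%:R)%:C -
    ((y ^+ k - x ^+ k) / k`!%:R)%:C).
  have -> : cexp (- c * x%:C) = cexp (- c * y%:C) * cexp (c * u%:C).
    by rewrite -cexpD; congr cexp; rewrite /u rmorphB /=; ring.
  rewrite [(- x%:C) ^+ k]exprNn [(- y%:C) ^+ k]exprNn !rmorphM /= fmorphV rmorph_nat.
  by rewrite (rmorphB _ (y ^+ k)) /= !rmorphXn /=; ring.
have nE : normc ((-1) ^+ k * cexp (- c * y%:C)) = expR (- (kappa * y)) * expR (- (kappa * y)).
  rewrite normcM normcX normcN normc1 expr1n mul1r normc_cexp -expRD.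
  by congr expR; case: (c) cE => a b /= ->; rewrite !mulr0 subr0; ring.
rewrite normcM nE.
have ey := expR_gt0 (- (kappa * y)).
have eyy : expR (- (kappa * y)) * expR (kappa * y) = 1.
  by rewrite -expRD addNr expR0.
have kx : x ^+ k / k`!%:R * kappa ^+ k <= expR (kappa * y).
  rewrite mulrAC -exprMn [_ * kappa]mulrC.
  apply: le_trans (exp_coeff_le_expR _ _) _; first by rewrite mulr_ge0// ltW.
  by rewrite ler_expR ler_wpM2l// ltW.
have kyx : (y ^+ k - x ^+ k) / k`!%:R * kappa ^+ k <= kappa * u * expR (kappa * y).
  case: k {kx nE} => [|k].
    by rewrite !expr0 subrr !mul0r !mulr_ge0 ?expR_ge0// ltW.
  rewrite -mulrA; apply: le_trans (ler_wpM2r _ (exprB_le k x0 xy)) _.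
    by rewrite mulr_ge0 ?exprn_ge0 ?(ltW k0).
  have -> : (y - x) * (k.+1%:R * y ^+ k) * ((k.+1)`!%:R^-1 * kappa ^+ k.+1) =
     kappa * u * ((kappa * y) ^+ k / k`!%:R).
    have F0 : k`!%:R != 0 :> R by rewrite pnatr_eq0 -lt0n fact_gt0.
    have N0 : k.+1%:R != 0 :> R by rewrite pnatr_eq0.
    rewrite factS natrM exprS exprMn -/u.
    move: (k.+1%:R : R) (k`!%:R : R) N0 F0 => N F N0 F0.
    by field; rewrite N0 F0.
  rewrite ler_wpM2l ?mulr_ge0 ?(ltW k0)//; apply: exp_coeff_le_expR.
  by rewrite mulr_ge0// ltW.
have cu : normc (cexp (c * u%:C) - 1) <= u * (normc c * expR (normc c)).
  apply: le_trans (normc_cexpB1 _) _.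
  rewrite normcM normcR ger0_norm// mulrAC [X in _ <= X]mulrC.
  rewrite ler_wpM2r// ler_wpM2l ?normc_ge0// ler_expR.
  by rewrite ler_piMr ?normc_ge0.
set q := (X in _ * normc X * _).
have qle : normc q * kappa ^+ k <=
    u * (normc c * expR (normc c) + kappa) * expR (kappa * y).
  apply: le_trans (_ : (normc (cexp (c * u%:C) - 1) * (x ^+ k / k`!%:R) +
      (y ^+ k - x ^+ k) / k`!%:R) * kappa ^+ k <= _).
    rewrite ler_wpM2r ?exprn_ge0 ?(ltW k0)//; apply: le_trans (le_normcD _ _) _.
    rewrite normcN normcM !normcR !ger0_norm//.
      by rewrite divr_ge0// subr_ge0 lerXn2r.
    by rewrite divr_ge0 ?exprn_ge0.
  rewrite mulrDl -mulrA mulrDr mulrDl lerD//; last by rewrite [u * _]mulrC.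
  apply: ler_pM => //; first exact: normc_ge0.
  by rewrite mulr_ge0 ?divr_ge0 ?exprn_ge0 ?(ltW k0).
rewrite -mulrA; apply: le_trans (ler_wpM2l _ qle) _; first by rewrite mulr_ge0 ?expR_ge0.
have -> : expR (- (kappa * y)) * expR (- (kappa * y)) *
  (u * (normc c * expR (normc c) + kappa) * expR (kappa * y)) =
  (normc c * expR (normc c) + kappa) / kappa *
    (expR (- (kappa * y)) * (kappa * u)) *
    (expR (- (kappa * y)) * expR (kappa * y)).
  by field; rewrite gt_eqF.
rewrite eyy mulr1; apply: ler_wpM2l.
  by rewrite divr_ge0 ?(ltW k0)// addr_ge0 ?(ltW k0)// mulr_ge0 ?normc_ge0 ?expR_ge0.
have -> : expR (- (kappa * x)) = expR (- (kappa * y)) * expR (kappa * u).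
  by rewrite -expRD; congr expR; rewrite /u; ring.
rewrite -[X in _ - X]mulr1 -mulrBr ler_wpM2l ?expR_ge0//.
by have := expR_ge1Dx (kappa * u); lra.
Qed.

Lemma ln_nat_ge0 n : 0 <= ln n.+1%:R :> R.
Proof. by rewrite ln_ge0// ler1n. Qed.

Lemma ln_natS_le n : ln n.+1%:R <= ln n.+2%:R :> R.
Proof. by rewrite ler_ln ?posrE// ler_nat. Qed.

Lemma ln_natSB_le1 n : ln n.+2%:R - ln n.+1%:R <= 1 :> R.
Proof.
rewrite -ln_div ?posrE//; apply: le_trans (_ : n.+2%:R / n.+1%:R - 1 <= _).
  rewrite -[X in ln X](subrKC 1); apply: le_ln1Dx.
  by rewrite ltrBrDl addrN divr_gt0.
rewrite lerBlDr ler_pdivrMr// -natr1.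
have : (1 : R) <= n.+1%:R by rewrite ler1n.
lra.
Qed.

Definition eta_majorant (K kappa : R) (n : nat) : R :=
  K * (expR (- (kappa * ln n.*2.+1%:R)) - expR (- (kappa * ln n.*2.+2%:R))).

(** The partial sums are alternating sums of a decreasing positive sequence,
    hence at most its first term. *)
Lemma eta_majorant_cvg K kappa : 0 <= K -> 0 <= kappa ->
  cvgn (series (eta_majorant K kappa)).
Proof.
move=> K0 k0; pose E n : R := expR (- (kappa * ln n.+1%:R)).
have Ele n : E n.+1 <= E n by rewrite ler_expR lerN2 ler_wpM2l// ln_natS_le.
have mE n : eta_majorant K kappa n = K * (E n.*2 - E n.*2.+1) by [].
apply: nondecreasing_is_cvgn.
  by apply: nondecreasing_series => n _ _; rewrite mE mulr_ge0// subr_ge0.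
exists (K * E 0%N) => _ [n _ <-].
apply: le_trans (_ : K * (E 0%N - E n.*2) <= _); last first.
  by rewrite ler_wpM2l// gerBl expR_ge0.
elim: n => [|n IH]; first by rewrite /series /= big_geq// subrr mulr0.
rewrite seriesSr mE; apply: le_trans (lerD IH (lexx _)) _.
rewrite -mulrDr ler_wpM2l// doubleS.
have := Ele n.*2.+1; lra.
Qed.

Lemma eta_coef_majorant c n k : 0 < complex.Re c ->
  normc (eta_coef c n k) * (complex.Re c / 2) ^+ k <=
  eta_majorant ((normc c * expR (normc c) + complex.Re c / 2) / (complex.Re c / 2))
    (complex.Re c / 2) n.
Proof.
move=> c0; apply: eta_coef_bound; first by rewrite divr_gt0.
- by rewrite mulrC divfK.
- exact: ln_nat_ge0.
- exact: ln_natS_le.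
- exact: ln_natSB_le1.
Qed.

Lemma eta_coef_majorant_cvg c : 0 < complex.Re c ->
  cvgn (series (eta_majorant
    ((normc c * expR (normc c) + complex.Re c / 2) / (complex.Re c / 2))
    (complex.Re c / 2))).
Proof.
move=> c0; have c2 : 0 <= complex.Re c / 2 by rewrite divr_ge0// ltW.
apply: eta_majorant_cvg => //.
by rewrite divr_ge0// addr_ge0// mulr_ge0 ?normc_ge0 ?expR_ge0.
Qed.

Lemma cvgC_eta s : 0 < complex.Re s -> cvgC (series (eta_term^~ s)) (eta s).
Proof.
move=> s0; suff [l sl] : exists l, cvgC (series (eta_term^~ s)) l.
  by apply: (xgetPex 0); exists l.
apply: cvgC_series_dom (eta_coef_majorant_cvg s0) => n.
have := eta_coef_majorant n 0 s0.
by rewrite mulr1 /eta_coef /eta_term !nat_powNE !expr0 fact0 !divr1 !mulr1.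
Qed.

Lemma analytic_eta c : 0 < complex.Re c ->
  analytic_at (eta : R[i]^o -> R[i]^o) c.
Proof.
move=> c0; have c2 : 0 < complex.Re c / 2 by rewrite divr_gt0.
apply: (@analytic_series _ eta_term _ _ (eta_coef c) (complex.Re c / 2)).
- exact: c2.
- by move=> n k; exact: eta_coef_majorant.
- exact: eta_coef_majorant_cvg.
- by move=> n w _; exact: cvgC_eta_coef.
- move=> w wc; apply: cvgC_eta.
  have -> : complex.Re (c + w) = complex.Re c + complex.Re w by case: c w {c0 c2 wc} => ? ? [].
  have := normr_Re_le w; have := ler_norm (- complex.Re w); rewrite normrN.
  move: c0 wc; lra.
Qed.

(** Splitting off the even terms of the Dirichlet series of zeta. *)
Lemma eta_zeta s (l : C) : 1 < complex.Re s ->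
  cvgC (series (fun n => nat_powN n.+1 s)) l ->
  eta s = (1 - 2 * nat_powN 2 s) * l.
Proof.
move=> s1 zs; apply: (@cvgC_unique _ (series (eta_term^~ s))).
  by apply: cvgC_eta; apply: lt_trans s1.
have nn n : (n <= n.*2)%N by rewrite -addnn leq_addr.
have zs2 := cvgC_subseq nn zs.
rewrite mulrBl mul1r.
have := cvgCB zs2 (cvgCM (cvgC_cst (2 * nat_powN 2 s)) zs).
congr cvgC; apply/funext => n /=.
elim: n => [|n IH]; first by rewrite /series /= !big_geq// mulr0 subrr.
rewrite doubleS !series_recr -IH mulrDr /eta_term.
have -> : nat_powN n.*2.+2 s = nat_powN 2 s * nat_powN n.+1 s.
  rewrite !nat_powNE -cexpD -mulrDr -rmorphD /= -lnM ?posrE// -natrM.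
  by rewrite mul2n doubleS.
ring.
Qed.

End DirichletEta.

(** * The identity theorem up to 1/2 *)

Section ZetaAtHalf.
Context {R : realType}.
Local Notation C := (R[i]).

(** The identity theorem along the half-line [1/2 + t (1 + i)], which avoids
    the pole and ends in the domain of the Dirichlet series. *)
Lemma zeta_half_eta (zeta : R[i]^o -> R[i]^o) : is_riemann_zeta zeta ->
  (1 - 2 * nat_powN 2 (2^-1 : R[i]^o)) * zeta 2^-1 = eta (2^-1 : C).
Proof.
move=> [zD zA]; pose h (s : C) : C := (1 - 2 * nat_powN 2 s) * zeta s - eta s.
pose d : C := 1 +i* 1.
have half : (2^-1 : C) = (2^-1)%:C by rewrite fmorphV rmorph_nat.
pose p (t : R) : C := 2^-1 + t%:C * d.
have pE t : p t = (2^-1 + t) +i* t.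
  by rewrite /p /d half; apply/eqP; rewrite eq_complex /=
    !(mulr1, mul0r, mulr0, subr0, addr0, add0r) !eqxx.
have hA (t : R) : 0 <= t -> analytic_at (h : R[i]^o -> R[i]^o) (p t).
  move=> t0; apply: analyticB; last first.
    by apply: analytic_eta; rewrite pE /=; lra.
  apply: analyticM.
    apply: analyticB; first exact: analytic_cst.
    by apply: analyticM; [exact: analytic_cst|exact: analytic_nat_powN].
  apply: zA; rewrite pE eq_complex /=; apply/negP => /andP[/eqP h1 /eqP h2].
  have [] : (2^-1 + t = 1 :> R) /\ (t = 0 :> R) by [].
  by move=> {h1 h2}; lra.
have h0 (t : R) : 1 <= t -> h (p t) = 0.
  move=> t1; have pt : 1 < complex.Re (p t) by rewrite pE /=; lra.
  have ze : cvgC (series (fun n => nat_powN n.+1 (p t))) (zeta (p t)).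
    by apply/cvgC_topE; exact: zD.
  by rewrite /h (eta_zeta pt ze) subrr.
(* [h] vanishes on the half-line beyond [p m], hence on a neighbourhood of [p m];
   for [m > 0] this contradicts the choice of [m] *)
pose T := [set t : R | 0 <= t /\ forall t', t < t' -> h (p t') = 0].
have T1 : T 1 by split=> // t' /ltW; exact: h0.
have lbT : lbound T 0 by move=> t [].
have hi : has_inf T by split; [exists 1|exists 0].
pose m := inf T.
have m0 : 0 <= m by apply: lb_le_inf => //; exists 1.
have hm (t : R) : m < t -> h (p t) = 0.
  move=> mt; have [u [_ uh] ut] := inf_lt hi.1 mt.
  exact: uh.
have [e e0 he] : exists2 e : R, 0 < e & forall z, normc (z - p m) < e -> h z = 0.
  apply: (@analytic_zero_germ _ _ _ d) (hA m m0) _ _.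
    by rewrite /d eq_complex /= oner_eq0.
  move=> t t0; rewrite (_ : p m + t%:C * d = p (m + t)); last first.
    by rewrite /p rmorphD /= mulrDl addrA.
  by apply: hm; rewrite ltrDl.
have near0 (t : R) : `|t - m| < e / 2 -> h (p t) = 0.
  move=> tm; apply: he; have -> : p t - p m = (t - m)%:C * d.
    by rewrite /p rmorphB /=; ring.
  rewrite normcM normcR; apply: le_lt_trans (_ : `|t - m| * 2 < _).
    apply: ler_wpM2l; first exact: normr_ge0.
    by apply: le_trans (normc_le_ReIm _) _; rewrite /= normr1.
  by rewrite -ltr_pdivlMr.
have [mE|mp] := eqVneq m 0.
  have : h (p 0) = 0.
    by apply: near0; rewrite mE subrr normr0 divr_gt0.
  by rewrite /h /p mul0r addr0 => /eqP; rewrite subr_eq0 => /eqP.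
have mpos : 0 < m by rewrite lt_neqAle eq_sym mp.
pose m' := Num.max 0 (m - e / 4).
have m'm : m' < m by rewrite gt_max mpos /= ltrBlDr ltrDl divr_gt0.
have Tm' : T m'.
  split; first by rewrite le_max lexx.
  move=> t; rewrite gt_max => /andP[t0 tm]; have [|mt] := leP t m; last exact: hm.
  move=> tm'; apply: near0; rewrite distrC ger0_norm ?subr_ge0//; lra.
have := ge_inf (ex_intro _ 0 lbT) Tm'.
by rewrite -/m leNgt m'm.
Qed.

End ZetaAtHalf.

(** * The numerical value of zeta at 1/2 *)

Section ZetaHalfValue.
Context {R : realType}.
Local Notation C := (R[i]).
Implicit Types (a b : R) (n : nat).

Definition sum_invsqrt n : R := \sum_(0 <= k < n) (Num.sqrt k.+1%:R)^-1.

(** The Euler-Maclaurin expansion of the partial sums of [1 / sqrt k], truncated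
    after the term of order [n ^ (- 3 / 2)], then after that of order
    [n ^ (- 7 / 2)]. *)
Definition zeta_half_upper n : R :=
  sum_invsqrt n - 2 * Num.sqrt n%:R - (2 * Num.sqrt n%:R)^-1 +
  (24 * Num.sqrt n%:R ^+ 3)^-1.

Definition zeta_half_lower n : R :=
  zeta_half_upper n - (384 * Num.sqrt n%:R ^+ 7)^-1.

(** For [b ^+ 2 = a ^+ 2 + 1] both [a] and [b] are rational in [d = b - a]:
    [a = (1 - d ^+ 2) / (2 * d)] and [b = (1 + d ^+ 2) / (2 * d)]. *)
Lemma consecutive_sqrt_param a b : 0 < a -> 0 < b -> b ^+ 2 = a ^+ 2 + 1 ->
  exists2 d : R, 0 < d < 1 &
    a = (1 - d ^+ 2) / (2 * d) /\ b = (1 + d ^+ 2) / (2 * d).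
Proof.
move=> a0 b0 ab; have ba : (b - a) * (b + a) = 1 by rewrite -subr_sqr ab addrC addKr.
have s0 : 0 < b + a by rewrite addr_gt0.
have d0 : 0 < b - a by rewrite -(pmulr_lgt0 _ s0) ba.
exists (b - a).
  rewrite d0 /=; nra.
have dn : b - a != 0 by rewrite gt_eqF.
have dn2 : 2 * (b - a) != 0 by rewrite mulf_neq0.
by split; apply: (mulIf dn2); rewrite divfK//; move: ba; lra.
Qed.

(** In the parameter [d], the difference of the two sides is [d ^ 9] times a
    rational function that is visibly nonnegative for [d < 1]. *)
Lemma upper_step a b : 0 < a -> 0 < b -> b ^+ 2 = a ^+ 2 + 1 ->
  b^-1 - 2 * b - (2 * b)^-1 + (24 * b ^+ 3)^-1 <=
  - (2 * a) - (2 * a)^-1 + (24 * a ^+ 3)^-1.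
Proof.
move=> a0 b0 /(consecutive_sqrt_param a0 b0)[d /andP[d0 d1] [-> ->]].
have x0 : 0 < d ^+ 2 by rewrite exprn_gt0.
have x1 : d ^+ 2 < 1 by rewrite expr_lt1// ltW.
have y0 : 0 < 1 - (d ^+ 2) ^+ 2 by rewrite subr_gt0 expr_lt1// ltW.
rewrite -subr_ge0.
have -> : - (2 * ((1 - d ^+ 2) / (2 * d))) - (2 * ((1 - d ^+ 2) / (2 * d)))^-1 +
  (24 * ((1 - d ^+ 2) / (2 * d)) ^+ 3)^-1 -
  (((1 + d ^+ 2) / (2 * d))^-1 - 2 * ((1 + d ^+ 2) / (2 * d)) -
   (2 * ((1 + d ^+ 2) / (2 * d)))^-1 + (24 * ((1 + d ^+ 2) / (2 * d)) ^+ 3)^-1) =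
  d ^+ 9 * (14 / 3 - 2 * (d ^+ 2) ^+ 2) / (1 - (d ^+ 2) ^+ 2) ^+ 3.
  field; rewrite !gt_eqF//=; lra.
rewrite divr_ge0 ?mulr_ge0 ?exprn_ge0 ?(ltW d0) ?(ltW y0)//; lra.
Qed.

Lemma lower_step a b : 0 < a -> 0 < b -> b ^+ 2 = a ^+ 2 + 1 ->
  - (2 * a) - (2 * a)^-1 + (24 * a ^+ 3)^-1 - (384 * a ^+ 7)^-1 <=
  b^-1 - 2 * b - (2 * b)^-1 + (24 * b ^+ 3)^-1 - (384 * b ^+ 7)^-1.
Proof.
move=> a0 b0 /(consecutive_sqrt_param a0 b0)[d /andP[d0 d1] [-> ->]].
have x0 : 0 < d ^+ 2 by rewrite exprn_gt0.
have x1 : d ^+ 2 < 1 by rewrite expr_lt1// ltW.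
have y0 : 0 < 1 - (d ^+ 2) ^+ 2 by rewrite subr_gt0 expr_lt1// ltW.
rewrite -subr_ge0.
set y := 1 - (d ^+ 2) ^+ 2 in y0.
have -> : ((1 + d ^+ 2) / (2 * d))^-1 - 2 * ((1 + d ^+ 2) / (2 * d)) -
   (2 * ((1 + d ^+ 2) / (2 * d)))^-1 + (24 * ((1 + d ^+ 2) / (2 * d)) ^+ 3)^-1 -
   (384 * ((1 + d ^+ 2) / (2 * d)) ^+ 7)^-1 -
  (- (2 * ((1 - d ^+ 2) / (2 * d))) - (2 * ((1 - d ^+ 2) / (2 * d)))^-1 +
  (24 * ((1 - d ^+ 2) / (2 * d)) ^+ 3)^-1 -
  (384 * ((1 - d ^+ 2) / (2 * d)) ^+ 7)^-1) =
  d ^+ 9 * ((14 + 70 * d ^+ 4 + 42 * d ^+ 8 + 2 * d ^+ 12) -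
     (14 - 6 * d ^+ 4) * y ^+ 4) / (3 * y ^+ 7).
  rewrite /y; field; rewrite !gt_eqF//=; lra.
rewrite divr_ge0 ?mulr_ge0 ?exprn_ge0 ?(ltW d0) ?(ltW y0)//.
have y1 : y ^+ 4 <= 1.
  by rewrite exprn_ile1 ?(ltW y0)// /y gerBl exprn_ge0 ?(ltW x0).
have d4 : d ^+ 4 <= 1 by rewrite exprn_ile1// ltW.
have h : (14 - 6 * d ^+ 4) * y ^+ 4 <= 14 - 6 * d ^+ 4.
  by rewrite ler_piMr//; lra.
have d40 : 0 <= d ^+ 4 by rewrite exprn_ge0// ltW.
have d80 : 0 <= d ^+ 8 by rewrite exprn_ge0// ltW.
have d120 : 0 <= d ^+ 12 by rewrite exprn_ge0// ltW.
lra.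
Qed.

Lemma sqrt_nat_gt0 n : 0 < Num.sqrt n.+1%:R :> R.
Proof. by rewrite sqrtr_gt0. Qed.

Lemma sqrt_nat_succ n : Num.sqrt n.+1%:R ^+ 2 = Num.sqrt n%:R ^+ 2 + 1 :> R.
Proof. by rewrite !sqr_sqrtr// natr1. Qed.

Lemma zeta_half_upper_decr n : zeta_half_upper n.+2 <= zeta_half_upper n.+1.
Proof.
have := upper_step (sqrt_nat_gt0 n) (sqrt_nat_gt0 n.+1) (sqrt_nat_succ n.+1).
rewrite /zeta_half_upper /sum_invsqrt [X in _ -> X - _ - _ + _ <= _]big_nat_recr//=.
lra.
Qed.

Lemma zeta_half_lower_incr n : zeta_half_lower n.+1 <= zeta_half_lower n.+2.
Proof.
have := lower_step (sqrt_nat_gt0 n) (sqrt_nat_gt0 n.+1) (sqrt_nat_succ n.+1).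
rewrite /zeta_half_lower /zeta_half_upper /sum_invsqrt.
rewrite [X in _ -> _ <= X - _ - _ + _ - _]big_nat_recr//=.
lra.
Qed.

Lemma zeta_half_lower_le_upper m n : zeta_half_lower m.+1 <= zeta_half_upper n.+1.
Proof.
have lu k : zeta_half_lower k.+1 <= zeta_half_upper k.+1.
  rewrite gerBl invr_ge0; apply: mulr_ge0; first exact: ler0n.
  exact: exprn_ge0 (ltW (sqrt_nat_gt0 k)).
have lm k j : (k <= j)%N -> zeta_half_lower k.+1 <= zeta_half_lower j.+1.
  by move: k j; apply: homo_leq le_trans _ => // k; exact: zeta_half_lower_incr.
have um k j : (k <= j)%N -> zeta_half_upper j.+1 <= zeta_half_upper k.+1.
  move: k j; apply: (homo_leq (r := fun x y => y <= x)) => //.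
    by move=> y x z yx zy; exact: le_trans yx.
  by move=> k; exact: zeta_half_upper_decr.
have [mn|nm] := leqP m n; first exact: le_trans (lm _ _ mn) (lu n).
exact: le_trans (lu m) (um _ _ (ltnW nm)).
Qed.

Lemma cvg_invsqrt : (fun n => (Num.sqrt n%:R)^-1) @ \oo --> (0 : R).
Proof.
apply/cvgrPdist_lt => e e0; near=> n.
have n0 : (0 < n)%N by near: n; exists 1%N.
have ne : e^-1 ^+ 2 < n%:R by near: n; exact: nbhs_infty_gtr.
rewrite sub0r normrN ger0_norm ?invr_ge0 ?sqrtr_ge0//.
rewrite invf_plt ?posrE ?sqrtr_gt0 ?ltr0n//.
rewrite -[e^-1]ger0_norm ?invr_ge0 ?(ltW e0)// -sqrtr_sqr ltr_sqrt//.
by rewrite ltr0n.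
Unshelve. all: by end_near. Qed.

(** A decreasing and an increasing sequence, the first above the second. *)
Lemma zeta_half_upper_cvg : exists2 L : R, zeta_half_upper @ \oo --> L &
  forall n, zeta_half_lower n.+1 <= L <= zeta_half_upper n.+1.
Proof.
have dec : nonincreasing_seq (fun n => zeta_half_upper n.+1).
  by apply/nonincreasing_seqP => n; exact: zeta_half_upper_decr.
have cu : cvgn (fun n => zeta_half_upper n.+1).
  apply: nonincreasing_is_cvgn => //; exists (zeta_half_lower 1).
  by move=> _ [n _ <-]; exact: zeta_half_lower_le_upper.
exists (limn (fun n => zeta_half_upper n.+1)).
  by rewrite -cvg_shiftS.
move=> n; apply/andP; split.
  apply: limr_ge => //; near=> m; exact: zeta_half_lower_le_upper.
exact: nonincreasing_cvgn_ge.
Unshelve. all: by end_near. Qed.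

Lemma half_complex : (2^-1 : C) = (2^-1)%:C.
Proof. by rewrite fmorphV rmorph_nat. Qed.

Lemma nat_powN_half n : nat_powN n.+1 (2^-1 : R[i]^o) = ((Num.sqrt n.+1%:R)^-1)%:C.
Proof.
rewrite nat_powNE half_complex -rmorphN -rmorphM /= cexp_real; congr (_%:C).
have l2 : expR (2^-1 * ln n.+1%:R) = Num.sqrt n.+1%:R :> R.
  rewrite -[LHS]ger0_norm ?expR_ge0// -sqrtr_sqr; congr Num.sqrt.
  rewrite expr2 -expRD (_ : _ + _ = ln n.+1%:R) ?lnK ?posrE//; lra.
by rewrite mulNr expRN l2.
Qed.

(** The even terms are subtracted twice, and [2 / sqrt (2 * n)] is
    [sqrt 2 / sqrt n]. *)
Lemma eta_half_partial n : series (eta_term^~ (2^-1 : C)) n =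
  (sum_invsqrt n.*2 - Num.sqrt 2 * sum_invsqrt n)%:C.
Proof.
elim: n => [|n IH].
  by rewrite /sum_invsqrt /series /= !big_geq// mulr0 subrr.
rewrite doubleS series_recr IH /eta_term !nat_powN_half -!rmorphB -rmorphD /=.
rewrite /sum_invsqrt !big_nat_recr//=; congr (_%:C).
have -> : Num.sqrt n.*2.+2%:R = Num.sqrt 2 * Num.sqrt n.+1%:R :> R.
  by rewrite -sqrtrM// -natrM mul2n doubleS.
have s2 : Num.sqrt 2 * Num.sqrt 2 = 2 :> R by rewrite -expr2 sqr_sqrtr.
have s20 : Num.sqrt 2 != 0 :> R by rewrite gt_eqF// sqrtr_gt0.
rewrite mulrDr.
have -> : Num.sqrt 2 * (Num.sqrt n.+1%:R)^-1 =
  2 * (Num.sqrt 2 * Num.sqrt n.+1%:R)^-1 :> R.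
  by rewrite invfM mulrA; congr (_ / _); apply: (mulIf s20); rewrite divfK.
ring.
Qed.

(** The divergent parts [2 * sqrt (2 * n)] and [sqrt 2 * (2 * sqrt n)] of the two
    partial sums cancel. *)
Lemma eta_half (L : R) : zeta_half_upper @ \oo --> L ->
  eta (2^-1 : C) = ((1 - Num.sqrt 2) * L)%:C.
Proof.
move=> uL; apply: (@cvgC_unique _ (series (eta_term^~ (2^-1 : C)))).
  by apply: cvgC_eta; rewrite half_complex /= invr_gt0.
pose r n : R := 2^-1 * (Num.sqrt n%:R)^-1 - 24^-1 *
    ((Num.sqrt n%:R)^-1 * (Num.sqrt n%:R)^-1 * (Num.sqrt n%:R)^-1).
have r0 : r @ \oo --> (0 : R).
  rewrite (_ : 0 = 2^-1 * 0 - 24^-1 * (0 * 0 * 0)); last by rewrite !mulr0 subr0.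
  apply: cvgB; first by apply: cvgM (cvg_cst _) cvg_invsqrt.
  apply: cvgM (cvg_cst _) _; exact: cvgM (cvgM cvg_invsqrt cvg_invsqrt) cvg_invsqrt.
have dbl : (double n @[n --> \oo] --> \oo).
  apply/cvgnyPge => A; near=> n; apply: leq_trans (_ : (n <= n.*2)%N).
    by near: n; exists A.
  by rewrite -addnn leq_addr.
have sE n : sum_invsqrt n = zeta_half_upper n + 2 * Num.sqrt n%:R + r n.
  rewrite /zeta_half_upper /r !invfM; ring.
have -> : series (eta_term^~ (2^-1 : C)) = (fun n =>
    (zeta_half_upper n.*2 - Num.sqrt 2 * zeta_half_upper n +
     (r n.*2 - Num.sqrt 2 * r n))%:C).
  apply/funext => n; rewrite eta_half_partial !sE; congr (_%:C).
  rewrite -mul2n natrM sqrtrM//; ring.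
apply: cvgC_real.
rewrite (_ : _ * L = L - Num.sqrt 2 * L + (0 - Num.sqrt 2 * 0)); last by ring.
apply: cvgD; apply: cvgB.
- exact: (cvg_comp _ _ dbl uL).
- by apply: cvgM uL; exact: cvg_cst.
- exact: (cvg_comp _ _ dbl r0).
- by apply: cvgM r0; exact: cvg_cst.
Unshelve. all: by end_near. Qed.

Lemma zeta_half_bounds (zeta : R[i]^o -> R[i]^o) : is_riemann_zeta zeta ->
  exists2 L : R, zeta 2^-1 = L%:C &
    forall n, zeta_half_lower n.+1 <= L <= zeta_half_upper n.+1.
Proof.
move=> zP; have [L uL Lb] := zeta_half_upper_cvg; exists L => //.
have := zeta_half_eta zP; rewrite (eta_half uL) nat_powN_half.
have s20 : Num.sqrt 2 != 0 :> R by rewrite gt_eqF// sqrtr_gt0.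
have -> : 2 * ((Num.sqrt 2)^-1)%:C = (Num.sqrt 2)%:C :> C.
  rewrite (_ : 2 = (2 : R)%:C); last by rewrite rmorph_nat.
  by rewrite -rmorphM /= -{1}(@sqr_sqrtr _ 2)// expr2 mulfK.
rewrite -(rmorph1 (real_complex R)) -rmorphB rmorphM /=.
apply: mulfI; rewrite eq_complex /= eqxx andbT subr_eq0 eq_sym gt_eqF//.
by rewrite -[ltLHS]sqrtr1 ltr_sqrt// ltr1n.
Qed.

Lemma invsqrt_ge (q x : R) : 0 <= q -> 0 < x -> q ^+ 2 * x <= 1 ->
  q <= (Num.sqrt x)^-1.
Proof.
move=> q0 x0 qx; rewrite -[leLHS]ger0_norm// -sqrtr_sqr -sqrtrV ?(ltW x0)//.
by rewrite ler_wsqrtr// -[leRHS]mul1r ler_pdivlMr.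
Qed.

Lemma invsqrt_le (q x : R) : 0 <= q -> 0 < x -> 1 <= q ^+ 2 * x ->
  (Num.sqrt x)^-1 <= q.
Proof.
move=> q0 x0 qx; rewrite -[leRHS]ger0_norm// -sqrtr_sqr -sqrtrV ?(ltW x0)//.
by rewrite ler_wsqrtr// -[leLHS]mul1r ler_pdivrMr.
Qed.

Lemma zeta_half_approx (L : R) :
  (forall n, zeta_half_lower n.+1 <= L <= zeta_half_upper n.+1) ->
  `|- L - (1 + 46 / 10 ^+ 2 + 35 / 10 ^+ 5)| <= 5 / 10 ^+ 6.
Proof.
(* nine terms: the bounds are [1 / (384 * 3 ^ 7)], about [1.2e-6], apart, and the
   lower one is within [1e-8] of the limit *)
move=> /(_ 8%N); rewrite /zeta_half_lower /zeta_half_upper.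
have -> : Num.sqrt 9%:R = 3 :> R.
  by rewrite (_ : 9%:R = 3 ^+ 2 :> R) ?sqrtr_sqr ?ger0_norm//; lra.
rewrite /sum_invsqrt.
rewrite !big_nat_recr//= big_geq// add0r.
have s1 : (Num.sqrt 1)^-1 = 1 :> R by rewrite sqrtr1 invr1.
have s4 : (Num.sqrt 4)^-1 = 2^-1 :> R.
  by rewrite (_ : 4 = 2 ^+ 2 :> R) ?sqrtr_sqr ?ger0_norm//; lra.
have s9 : (Num.sqrt 9)^-1 = 3^-1 :> R.
  by rewrite (_ : 9 = 3 ^+ 2 :> R) ?sqrtr_sqr ?ger0_norm//; lra.
rewrite s1 s4 s9.
have b2 : 70 / 10 ^+ 2 + 71 / 10 ^+ 4 + 6 / 10 ^+ 6 + 78 / 10 ^+ 8 <= (Num.sqrt (2 : R))^-1 <=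
    70 / 10 ^+ 2 + 71 / 10 ^+ 4 + 6 / 10 ^+ 6 + 79 / 10 ^+ 8.
  by clear; apply/andP; split; [apply: invsqrt_ge|apply: invsqrt_le]; lra.
have b3 : 57 / 10 ^+ 2 + 73 / 10 ^+ 4 + 50 / 10 ^+ 6 + 26 / 10 ^+ 8 <= (Num.sqrt (3 : R))^-1 <=
    57 / 10 ^+ 2 + 73 / 10 ^+ 4 + 50 / 10 ^+ 6 + 27 / 10 ^+ 8.
  by clear; apply/andP; split; [apply: invsqrt_ge|apply: invsqrt_le]; lra.
have b5 : 44 / 10 ^+ 2 + 72 / 10 ^+ 4 + 13 / 10 ^+ 6 + 59 / 10 ^+ 8 <= (Num.sqrt (5 : R))^-1 <=
    44 / 10 ^+ 2 + 72 / 10 ^+ 4 + 13 / 10 ^+ 6 + 60 / 10 ^+ 8.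
  by clear; apply/andP; split; [apply: invsqrt_ge|apply: invsqrt_le]; lra.
have b6 : 40 / 10 ^+ 2 + 82 / 10 ^+ 4 + 48 / 10 ^+ 6 + 29 / 10 ^+ 8 <= (Num.sqrt (6 : R))^-1 <=
    40 / 10 ^+ 2 + 82 / 10 ^+ 4 + 48 / 10 ^+ 6 + 30 / 10 ^+ 8.
  by clear; apply/andP; split; [apply: invsqrt_ge|apply: invsqrt_le]; lra.
have b7 : 37 / 10 ^+ 2 + 79 / 10 ^+ 4 + 64 / 10 ^+ 6 + 47 / 10 ^+ 8 <= (Num.sqrt (7 : R))^-1 <=
    37 / 10 ^+ 2 + 79 / 10 ^+ 4 + 64 / 10 ^+ 6 + 48 / 10 ^+ 8.
  by clear; apply/andP; split; [apply: invsqrt_ge|apply: invsqrt_le]; lra.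
have b8 : 35 / 10 ^+ 2 + 35 / 10 ^+ 4 + 53 / 10 ^+ 6 + 39 / 10 ^+ 8 <= (Num.sqrt (8 : R))^-1 <=
    35 / 10 ^+ 2 + 35 / 10 ^+ 4 + 53 / 10 ^+ 6 + 40 / 10 ^+ 8.
  by clear; apply/andP; split; [apply: invsqrt_ge|apply: invsqrt_le]; lra.
move: b2 b3 b5 b6 b7 b8 => /andP[? ?] /andP[? ?] /andP[? ?] /andP[? ?] /andP[? ?].
move=> /andP[? ?] /andP[? ?].
rewrite ler_norml; apply/andP; split; lra.
Qed.

End ZetaHalfValue.

Theorem theorem5p1 (R : realType) (zeta : R[i]^o -> R[i]^o)
  (iota : set R -> R)
  (zetaP : is_riemann_zeta zeta)
  (iota_ess : iota (P_ess R) = - complex.Re (zeta 2^-1))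
  (iota_third : iota (C_third R) = 0) :
  [/\ zeta 2^-1 = (complex.Re (zeta 2^-1))%:C,
      info_card iota (P_ess R) =
        (1%N, (2^-1)%:E, - complex.Re (zeta 2^-1)),
      info_approx (5 / 10 ^+ 6) (info_card iota (P_ess R))
        (1%N, (5 / 10)%:E, 1 + 46 / 10 ^+ 2 + 35 / 10 ^+ 5),
      info_card iota (C_third R) = (1%N, (3^-1)%:E, 0) &
      info_approx (5 / 10 ^+ 4) (info_card iota (C_third R))
        (1%N, (333 / 10 ^+ 3)%:E, 0)].
Proof.
have [L zL /zeta_half_approx Lapprox] := zeta_half_bounds zetaP.
have ReL : complex.Re (zeta 2^-1) = L by rewrite zL.
have essE : info_card iota (P_ess R) = (1%N, (2^-1)%:E, - L).
  rewrite (info_card_self_similar iota P_ess_self_similar _ powR_ess) ?invr_gt0//.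
  by rewrite iota_ess ReL.
have thirdE : info_card iota (C_third R) = (1%N, (3^-1)%:E, 0).
  rewrite (info_card_self_similar iota C_third_self_similar _ powR_third) ?invr_gt0//.
  by rewrite iota_third.
split; rewrite ?ReL //.
- rewrite essE; split => //=.
  by rewrite lee_fin ler_norml; apply/andP; split; lra.
- rewrite thirdE; split => //=.
    by rewrite lee_fin ler_norml; apply/andP; split; lra.
  by rewrite subr0 normr0; lra.
Qed.
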